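(* Let $s\ge 2$ be an even integer, let $\boldsymbol{\xi}$ be an environment, and consider the $(s,\boldsymbol{\xi})$-TBRW $\{(T_n,X_n)\}_{n\ge 0}$. For every initial state $(T_0,x_0)$ with $T_0$ finite: (i) If there exist a constant $c>0$ and a function $g:\mathbb{N}\setminus\{0\}\to(0,\infty)$ with $\sum_{n\ge1}1/g(n)=\infty$ such that $P\big(\limsup_{n\to\infty} S_n/g(n)\le c\big)=1$, then the TBRW is recurrent. (ii) If the random variables $\xi_n$, $n\ge0$, are independent and there exist a constant $c>0$ and a function $f:\mathbb{N}\setminus\{0\}\to(0,\infty)$ with $\sum_{n\ge1}1/f(n)<\infty$ such that $P\big(\liminf_{n\to\infty} S_n/f(n)\ge c\big)=1$, then $\mathbb{P}_{T_0,x_0,s,\boldsymbol{\xi}}$-almost surely there exists $n$ such that the walker gets trapped at time $n$; that is, $$\mathbb{P}_{T_0,x_0,s,\boldsymbol{\xi}}\Big(\text{there exist } x\in\textstyle\bigcup_n V(T_n)\text{ and } k \text{ such that } X_{sn+k}=x\ \text{for all } n\ge 0\Big)=1 .$$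
   Context: **Tree Builder Random Walk (TBRW).** Parameters: an integer $s\ge1$ and an environment $\boldsymbol{\xi}=\{\xi_n\}_{n\ge0}$, a sequence of non-negative integer valued random variables with law $P$. The initial state is $(T_0,x_0)$, where $T_0$ is a locally finite tree and $x_0\in V(T_0)$; $T_0$ may carry one self-loop, located at a distinguished vertex called the root. $T_0$ has at least one edge (a single vertex with a self-loop is allowed), so the walk is always defined. Given a realization of $\boldsymbol{\xi}$, set $X_0=x_0$ and define inductively for $n\ge 0$: (1) if $n\equiv 0 \pmod s$, $T_{n+1}$ is obtained from $T_n$ by attaching $\xi_n$ new leaves to $X_n$; otherwise $T_{n+1}=T_n$; (2) choose uniformly at random (independently of everything else given the past and $\boldsymbol{\xi}$) one of the edges of $T_{n+1}$ incident to $X_n$ (a self-loop counts as one edge), and let $X_{n+1}$ be its other endpoint ($X_{n+1}=X_n$ if the self-loop is chosen). The law of the process is $\mathbb{P}_{T_0,x_0,s,\boldsymbol{\xi}}$. **Notation.** $S_n:=\sum_{j=1}^n\xi_{sj}$. **Recurrence.** The TBRW started from $(T_0,x_0)$ is recurrent if for every $n\ge0$, every pair $(\widetilde T,x)$ that is attained by $(T_n,X_n)$ with positive probability and every $z\in V(\widetilde T)$, one has $\mathbb{P}_{T_0,x_0,s,\boldsymbol{\xi}}\big(X_m=z\text{ for infinitely many } m\,\big|\,T_n=\widetilde T,\,X_n=x\big)=1$. **Trapped.** The walker gets trapped at time $n$ if $X_{n+2m}=X_n$ for all $m\ge0$. *)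

(* Defs.v *)
From HB Require Import structures.
From mathcomp Require Import all_boot all_order all_algebra finmap.
From mathcomp Require Import all_classical all_reals all_analysis.

Set Implicit Arguments.
Unset Strict Implicit.
Unset Printing Implicit Defensive.

Import Order.TTheory GRing.Theory Num.Theory.

Local Open Scope classical_set_scope.
Local Open Scope ring_scope.

(* A finite tree that may carry one self-loop, at its root.  The relation
   [adj] is the loopless adjacency of the tree; [has_edge] excludes only the
   one-vertex tree without self-loop. *)
Record rooted_tree := RootedTree {
  vert : finType;
  adj : rel vert;
  tree_root : vert;
  self_loop : bool;
  adj_sym : symmetric adj;
  adj_irr : irreflexive adj;
  adj_connected : forall x y : vert, connect adj x y;
  adj_acyclic : forall c : seq vert, ucycle adj c -> (size c <= 2)%N;
  has_edge : self_loop \/ exists x y : vert, adj x y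
}.

(* Vertices of the evolving trees: [inl v] is a vertex of the initial tree and
   [inr (n, i)] is the i-th leaf (counted from 0) attached at step n. *)
Definition vertex (T0 : rooted_tree) : countType :=
  (vert T0 + nat * nat)%type.

(* A finite graph is the pair of its vertex set and its edge set.  An edge
   between x != y is recorded as both (x, y) and (y, x); a self-loop at x is
   the single pair (x, x). *)
Definition graph (V : choiceType) := ({fset V} * {fset V * V})%type.

Definition vertices (V : choiceType) (G : graph V) : {fset V} := G.1.

Definition edges (V : choiceType) (G : graph V) : {fset V * V} := G.2.

Definition attach (V : choiceType) (G : graph V) (x : V) (L : {fset V}) :
    graph V :=
  ((vertices G `|` L)%fset,
   (edges G `|` [fset (x, y) | y in L] `|` [fset (y, x) | y in L])%fset).

(* Since G has no multiple edges, the edges incident to x (a self-loop counted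
   once) correspond bijectively to their other endpoints. *)
Definition endpoints (V : choiceType) (G : graph V) (x : V) : {fset V} :=
  [fset e.2 | e in edges G & e.1 == x]%fset.

(* Probability that a uniformly chosen edge of G incident to x leads to y. *)
Definition step_prob (R : realType) (V : choiceType) (G : graph V) (x y : V) :
    R :=
  if y \in endpoints G x then (#|` endpoints G x|%:R)^-1 else 0.

Section TreeBuilder.
Context (T0 : rooted_tree) (s : nat).
Local Notation V := (vertex T0).

Definition initial_graph : graph V :=
  ([fset (inl v : V) | v in {: vert T0}]%fset,
   [fset ((inl e.1, inl e.2) : V * V) | e in {: vert T0 * vert T0}
     & adj e.1 e.2 || [&& self_loop T0, e.1 == tree_root T0 & e.2 == tree_root T0]]%fset).

Definition new_leaves (n k : nat) : {fset V} :=
  [fset (inr (n, i) : V) | i in iota 0 k]%fset.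

(* T_n, as a function of the environment k and of the trajectory x. *)
Fixpoint tree (k : nat -> nat) (x : nat -> V) (n : nat) : graph V :=
  if n is m.+1 then
    if (s %| m)%N then attach (tree k x m) (x m) (new_leaves m (k m))
    else tree k x m
  else initial_graph.

Context (R : realType) (d : measure_display) (Omega : measurableType d)
  (P : probability Omega R).
Implicit Types (xi : nat -> {RV P >-> nat}) (X : nat -> Omega -> V).

Definition random_tree xi X (n : nat) (w : Omega) : graph V :=
  tree (xi ^~ w) (X ^~ w) n.

(* X is the walk of the TBRW started from (T0, x0) in the environment xi.  The
   last clause is the transition rule: given xi_0, ..., xi_m, for any m >= n,
   and X_0, ..., X_n, the vertex X_(n+1) is the endpoint of a uniformly chosen
   edge of T_(n+1) incident to X_n.  As m is arbitrary, the conditioning is on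
   the whole environment: these cylinders generate sigma(xi, X_0, ..., X_n). *)
Definition is_TBRW (x0 : vert T0) xi X : Prop :=
  [/\ forall (n : nat) (A : set V), measurable (X n @^-1` A),
      forall w, X 0%N w = inl x0
    & forall (n m : nat) (k : nat -> nat) (x : nat -> V), (n <= m)%N ->
        P [set w | (forall i, (i <= m)%N -> xi i w = k i) /\
                   (forall i, (i <= n.+1)%N -> X i w = x i)]
        = (P [set w | (forall i, (i <= m)%N -> xi i w = k i) /\
                      (forall i, (i <= n)%N -> X i w = x i)]
           * (step_prob R (tree k x n.+1) (x n) (x n.+1))%:E)%E].

Definition cond_prob (A B : set Omega) : R := fine (P (A `&` B)) / fine (P B).

Definition recurrent xi X : Prop :=
  forall (n : nat) (T : graph V) (x : V),
    let B := [set w | random_tree xi X n w = T /\ X n w = x] in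
    (0 < P B)%E ->
    forall z : V, z \in vertices T ->
      cond_prob [set w | forall N, exists2 m, (N <= m)%N & X m w = z] B = 1.

Definition trapped_at X (n : nat) (w : Omega) : Prop :=
  forall m : nat, X (n + 2 * m)%N w = X n w.

Definition mutually_independent xi : Prop :=
  forall (I : {fset nat}) (A : nat -> set nat),
    fine (P [set w | forall i, i \in I -> A i (xi i w)])
    = \prod_(i <- I) fine (P (xi i @^-1` A i)).

Definition S_ xi (n : nat) (w : Omega) : nat :=
  (\sum_(1 <= j < n.+1) xi (s * j)%N w)%N.

End TreeBuilder.

(* Main.v *)
Require Import Defs.
From mathcomp Require Import all_boot all_order all_algebra finmap.
From mathcomp Require Import all_classical all_reals all_analysis.
From mathcomp Require Import measurable_realfun.
From mathcomp Require Import zify ring lra.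

(** For a directed edge (a, b), conditional Borel-Cantelli shows that a.s.
    a -> b is crossed infinitely often iff the sum over the visits to a of
    1/deg(a) diverges, a condition that does not involve b.  Since every edge
    other than the self-loop is a bridge, a -> b is crossed infinitely often iff
    b -> a is.  Hence a.s. either all edges are crossed infinitely often, in
    both directions, or none is.  In the latter case the self-loop is eventually
    avoided; then, as s is even, the bipartition of the tree confines the walker
    at even times to a finite set, new vertices remain leaves, and the walker
    ends up bouncing between one vertex and leaves of it, i.e. it is trapped.

    (i) If the walker is trapped at x, then the visits to x at the times sj
    contribute at least the sum of 1/(A + 2 S_j), which diverges: so the edges
    at x are crossed infinitely often, a contradiction.

    (ii) It suffices that one edge (v, w), the self-loop if there is one, is
    a.s. crossed finitely often.  Condition on the environment, root the tree at
    v, and consider U(x) = E_x[beta^tau], where tau is the crossing time of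
    (v, w) for simple random walk on the current tree.  Attaching k leaves to
    the position X of the walker turns U(X) into at most
    U(X) / (1 + k (1 - beta^2) U(X)), because only one neighbour of X leads
    towards v.  By convexity 1/E[U(X_n)] then grows by at least k (1 - beta^2)
    at each growth step, up to the discount factor, and with
    beta = 1 - 1/(2L) the probability of crossing (v, w) during [L, 2L) is
    O(L / S_(L/s)).  For L ~ s 2^i these bounds are summable, by Cauchy
    condensation. *)

Set Implicit Arguments.
Unset Strict Implicit.
Unset Printing Implicit Defensive.

Import Order.TTheory GRing.Theory Num.Theory.
Import numFieldNormedType.Exports.

Local Open Scope classical_set_scope.
Local Open Scope ring_scope.

(** * Trees grown by attaching leaves *)

Section Graphs.
Context (V : choiceType).
Implicit Types (G : graph V) (L : {fset V}).

Lemma mem_endpoints G (x y : V) :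
  (y \in endpoints G x) = ((x, y) \in edges G).
Proof.
apply/imfsetP/idP => [[[a b] /= /andP[abG /eqP <-] ->]//|xyG].
by exists (x, y) => //=; rewrite inE /= xyG eqxx.
Qed.

Lemma mem_vertices_attach G x L (a : V) :
  (a \in vertices (attach G x L)) = (a \in vertices G) || (a \in L).
Proof. by rewrite in_fsetU. Qed.

Lemma mem_edges_attach G x L (a b : V) :
  ((a, b) \in edges (attach G x L)) =
  [|| (a, b) \in edges G, (a == x) && (b \in L) | (b == x) && (a \in L)].
Proof.
rewrite !in_fsetU -orbA; congr [|| _, _ | _].
- apply/imfsetP/andP => [[y /= yL [-> ->]]//|[/eqP -> bL]].
  by exists b.
- apply/imfsetP/andP => [[y /= yL [-> ->]]//|[/eqP -> aL]].
  by exists a.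
Qed.

Lemma eq_graph G H : vertices G =i vertices H -> edges G =i edges H -> G = H.
Proof. by case: G H => [A E] [A' E'] /fsetP /= -> /fsetP /= ->. Qed.

Lemma attach_fset0 G x : attach G x fset0 = G.
Proof.
apply: eq_graph => [a|[a b]]; first by rewrite mem_vertices_attach inE orbF.
by rewrite mem_edges_attach !inE !andbF !orbF.
Qed.

Lemma attach_fsetU1 G x y L :
  attach G x (y |` L)%fset = attach (attach G x L) x [fset y]%fset.
Proof.
apply: eq_graph => [a|[a b]].
  by rewrite !mem_vertices_attach !inE orbAC orbA.
rewrite !mem_edges_attach !inE.
by case: (_ \in edges _); case: (a == x); case: (b == x); case: (a == y);
  case: (b == y); case: (a \in L); case: (b \in L).
Qed.

(* [E0] consists of the edges carried by the root, i.e. a possible self-loop. *)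
Inductive grown (v : V) (E0 : {fset V * V}) : graph V -> Prop :=
| grown_root : grown v E0 ([fset v]%fset, E0)
| grown_leaf G x y : grown v E0 G -> x \in vertices G -> y \notin vertices G ->
    grown v E0 (attach G x [fset y]%fset).

Section Grown.
Context (v : V) (E0 : {fset V * V}).
Hypothesis E0_loop : forall e, e \in E0 -> e = (v, v).

(** Leaves are attached one at a time, so that every tree invariant only has to be checked for a
    single new leaf. *)
Lemma grown_attach G x L : grown v E0 G -> x \in vertices G ->
  (forall y, y \in L -> y \notin vertices G) -> grown v E0 (attach G x L).
Proof.
move=> gG xG; elim/finSet_rect: L => L IH fresh.
have [->|[y yL]] := fset_0Vmem L; first by rewrite attach_fset0.
rewrite -(fsetD1K yL) attach_fsetU1; constructor.
- apply: IH; first by rewrite fproperD1.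
  by move=> z /fsetD1P[_]; exact: fresh.
- by rewrite mem_vertices_attach xG.
- by rewrite mem_vertices_attach !inE eqxx orbF fresh.
Qed.

Lemma grown_mem_root G : grown v E0 G -> v \in vertices G.
Proof. by elim=> [|H x y _ IH _ _]; rewrite ?mem_vertices_attach ?IH// !inE. Qed.

Lemma grown_edge_vertices G a b : grown v E0 G -> (a, b) \in edges G ->
  (a \in vertices G) && (b \in vertices G).
Proof.
move=> gG; elim: gG a b => [a b /E0_loop[-> ->]|H x y _ IH xH _ a b].
  by rewrite !inE eqxx.
rewrite mem_edges_attach !mem_vertices_attach !inE.
case/or3P => [/IH/andP[-> ->]//|/andP[/eqP -> /eqP ->]|/andP[/eqP -> /eqP ->]];
  by rewrite eqxx xH !orbT.
Qed.

Lemma grown_sym G a b : grown v E0 G -> (a, b) \in edges G -> (b, a) \in edges G.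
Proof.
move=> gG; elim: gG a b => [a b /= abE|H x y _ IH xH _ a b].
  by case: (E0_loop abE) (abE) => -> ->.
rewrite !mem_edges_attach => /or3P[/IH ->//|->|->]; by rewrite !orbT.
Qed.

Lemma grown_self_loop G a : grown v E0 G -> (a, a) \in edges G -> a = v.
Proof.
elim=> [/E0_loop[]//|H x y _ IH xH yH].
rewrite mem_edges_attach orbb !inE.
case/orP=> [/IH//|/andP[/eqP -> /eqP xy]].
by move: xH; rewrite xy (negbTE yH).
Qed.

Lemma fresh_neq G y c : y \notin vertices G -> c \in vertices G -> (c == y) = false.
Proof. by move=> yG cG; apply/negbTE/eqP => cy; rewrite -cy cG in yG. Qed.

Lemma grown_fresh_edge G y b : grown v E0 G -> y \notin vertices G ->
  ((y, b) \in edges G = false) * ((b, y) \in edges G = false).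
Proof.
move=> gG yG; split; apply/negbTE/negP => /(grown_edge_vertices gG);
  by rewrite (negbTE yG) ?andbF.
Qed.

(** Connectedness without paths: what is inherited along edges spreads to the whole tree, since a
    new leaf and its neighbour pass [Z] to each other in both directions. *)
Lemma grown_connected G (Z : V -> Prop) : grown v E0 G ->
  (forall a b, (a, b) \in edges G -> Z a -> Z b) ->
  forall a b, a \in vertices G -> b \in vertices G -> Z a -> Z b.
Proof.
elim=> [_ a b|H x y gH IH xH yH ZG].
  by rewrite !inE => /eqP -> /eqP ->.
have ZH a b : (a, b) \in edges H -> Z a -> Z b.
  by move=> abH; apply: ZG; rewrite mem_edges_attach abH.
have Zxy : Z x <-> Z y.
  by split; apply: ZG; rewrite mem_edges_attach !inE !eqxx ?orbT.
move=> a b; rewrite !mem_vertices_attach !inE.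
case/orP => [aH|/eqP ->]; case/orP => [bH|/eqP ->] //.
- exact: IH.
- by move=> Za; apply/Zxy; exact: (IH ZH a).
- by move=> /Zxy Zx; exact: (IH ZH x).
Qed.

(** A new leaf gets the colour opposite to its neighbour's; [a != b] exempts the self-loop. *)
Lemma grown_bicolored G : grown v E0 G -> exists chi : V -> bool,
  forall a b, (a, b) \in edges G -> a != b -> chi a != chi b.
Proof.
elim=> [|H x y gH [chi chiH] xH yH].
  by exists xpredT => a b /E0_loop[-> ->]; rewrite eqxx.
exists (fun z => if z == y then ~~ chi x else chi z) => a b.
have xy := fresh_neq yH xH.
rewrite mem_edges_attach !inE.
case/or3P => [abH ab|/andP[/eqP -> /eqP ->]|/andP[/eqP -> /eqP ->]].
- have /andP[aH bH] := grown_edge_vertices gH abH.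
  by rewrite !(fresh_neq yH)//; exact: chiH.
- by rewrite eqxx xy => _; case: (chi x).
- by rewrite eqxx xy => _; case: (chi x).
Qed.

(** [phi] separates the two sides left by deleting the edge. When a leaf arrives, an old [phi] gives
    it the value of its neighbour, and the new edge is cut by the indicator of the leaf. *)
Lemma grown_bridge G a b : grown v E0 G -> (a, b) \in edges G -> a != b ->
  exists2 phi : V -> bool, phi a != phi b &
    forall c d, (c, d) \in edges G -> phi c != phi d ->
      (c, d) = (a, b) \/ (c, d) = (b, a).
Proof.
move=> gG; elim: gG a b => [a b /E0_loop[-> ->]|H x y gH IH xH yH a b].
  by rewrite eqxx.
have xy := fresh_neq yH xH.
have leaf_bridge c d : (c, d) \in edges (attach H x [fset y]%fset) ->
    (c == y) != (d == y) -> (c, d) = (x, y) \/ (c, d) = (y, x).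
  rewrite mem_edges_attach !inE.
  case/or3P => [|/andP[/eqP -> /eqP ->]|/andP[/eqP -> /eqP ->]].
  - move/(grown_edge_vertices gH) => /andP[cH dH].
    by rewrite !(fresh_neq yH).
  - by left.
  - by right.
rewrite mem_edges_attach !inE.
case/or3P => [abH ab|/andP[/eqP -> /eqP ->]|/andP[/eqP -> /eqP ->]].
- have [phi phiab phiH] := IH _ _ abH ab.
  have /andP[aH bH] := grown_edge_vertices gH abH.
  have neq c := @fresh_neq H y c yH.
  exists (fun z => if z == y then phi x else phi z); first by rewrite !neq.
  move=> c d; rewrite mem_edges_attach !inE.
  case/or3P => [cdH|/andP[/eqP -> /eqP ->]|/andP[/eqP -> /eqP ->]].
  + have /andP[cH dH] := grown_edge_vertices gH cdH.
    by rewrite !neq//; exact: phiH.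
  + by rewrite eqxx xy eqxx.
  + by rewrite eqxx xy eqxx.
- move=> _; exists (pred1 y); first by rewrite /= eqxx xy.
  exact: leaf_bridge.
- move=> _; exists (pred1 y); first by rewrite /= eqxx xy.
  by move=> c d cd cdy; case: (leaf_bridge c d cd cdy); [right|left].
Qed.

(* [D a z] reads "z is a descendant of a" in the tree rooted at [v]. *)
Definition descendants G (D : V -> V -> bool) :=
  [/\ forall a, a \in vertices G -> D a a /\ D v a,
      forall a c d, a \in vertices G -> (c, d) \in edges G ->
        D a c -> ~~ D a d -> c = a,
      forall a c d, (a, c) \in edges G -> (a, d) \in edges G ->
        ~~ D a c -> ~~ D a d -> c = d
    & forall a, a \in vertices G -> D a v -> a = v].

Lemma grown_descendants G : grown v E0 G -> exists D, descendants G D.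
Proof.
elim=> [|H x y gH [D [Drefl Dcut Duniq Droot]] xH yH].
  exists (fun a z => (a == v) || (a == z)); split => [a|a c d||a].
  - by rewrite !inE => /eqP ->; rewrite eqxx.
  - by rewrite !inE => /eqP -> _; rewrite eqxx.
  - by move=> a c d /E0_loop[-> ->]; rewrite eqxx.
  - by rewrite orbb => _ /eqP.
have neq c := @fresh_neq H y c yH.
have vH := grown_mem_root gH.
(* The leaf [y] descends from itself, from [x] and from the ancestors of [x]; no old vertex descends
   from [y]. *)
exists (fun a z => if z == y then (a == y) || D a x
                   else (a != y) && D a z); split.
- move=> a; rewrite mem_vertices_attach !inE => /orP[aH|/eqP ->].
    by rewrite !neq//=; exact: Drefl.
  by rewrite eqxx /=; split => //; rewrite (Drefl _ xH).2 orbT.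
- move=> a c d aG; rewrite mem_edges_attach !inE.
  case/or3P => [cdH|/andP[/eqP -> /eqP ->]|/andP[/eqP -> /eqP ->]].
  + have /andP[cH dH] := grown_edge_vertices gH cdH.
    rewrite (neq c)// (neq d)//; move: aG; rewrite mem_vertices_attach !inE.
    by case/orP => [aH|/eqP ->]; [rewrite neq//=; exact: Dcut|rewrite eqxx].
  + by rewrite eqxx (neq x)//= => /andP[ay ->]; rewrite orbT.
  + by rewrite eqxx (neq x)//=; case: (eqVneq a y) => [->//|_] /= ->.
- move=> a c d; rewrite !mem_edges_attach !inE.
  have [->|ay] := eqVneq a y.
    rewrite !(grown_fresh_edge _ gH yH) [y == x]eq_sym neq//= !andbT.
    by move=> /eqP -> /eqP ->.
  rewrite !andbF !orbF /=.
  case/orP => [acH|/andP[/eqP ax /eqP cy]]; last first.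
    by rewrite cy eqxx /= ax (Drefl _ xH).1.
  case/orP => [adH|/andP[/eqP ax /eqP dy]]; last first.
    by rewrite dy eqxx /= ax (Drefl _ xH).1.
  have /andP[_ cH] := grown_edge_vertices gH acH.
  have /andP[_ dH] := grown_edge_vertices gH adH.
  by rewrite (neq c)// (neq d)//=; exact: Duniq.
- move=> a; rewrite mem_vertices_attach !inE (neq v)//=.
  by case/orP => [aH /andP[_]|/eqP ->]; [exact: Droot|rewrite eqxx].
Qed.

End Grown.
End Graphs.

(** * The initial tree is grown *)

Section InitialTree.
Context (T0 : rooted_tree).
Local Notation V := (vertex T0).

Definition edge0 (a b : vert T0) :=
  adj a b || [&& self_loop T0, a == tree_root T0 & b == tree_root T0].

(** These graphs interpolate between a single vertex and the initial tree, [A] being enlarged by one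
    vertex at a time. *)
Definition induced_graph (A : {set vert T0}) : graph V :=
  ([fset (inl a : V) | a in A]%fset,
   [fset ((inl e.1, inl e.2) : V * V) | e in {: vert T0 * vert T0}
     & [&& e.1 \in A, e.2 \in A & edge0 e.1 e.2]]%fset).

Lemma mem_induced_vertices A (p : V) : (p \in vertices (induced_graph A)) =
  if p is inl a then a \in A else false.
Proof.
apply/imfsetP/idP => [[a /= aA ->]//|].
by case: p => [a aA|//]; exists a.
Qed.

Lemma mem_induced_edges A (p q : V) : ((p, q) \in edges (induced_graph A)) =
  match p, q with
  | inl a, inl b => [&& a \in A, b \in A & edge0 a b]
  | _, _ => false
  end.
Proof.
apply/imfsetP/idP => [[[a b] /=]|].
  by rewrite inE /= => abA [-> ->].
case: p q => [a|//] [b|//] abA.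
by exists (a, b).
Qed.

Lemma induced_graphT : induced_graph [set: vert T0]%SET = initial_graph T0.
Proof.
apply: eq_graph => [p|[p q]].
  rewrite mem_induced_vertices; apply/idP/imfsetP => [|[a _ ->]]; rewrite ?inE//.
  by case: p => [a _|//]; exists a.
rewrite mem_induced_edges; apply/idP/imfsetP => [|[[a b] /=]].
  case: p q => [a|//] [b|//]; rewrite !inE /= => ab.
  by exists (a, b).
by rewrite inE /= => ab [-> ->]; rewrite !inE.
Qed.

Lemma edge0_sym a b : edge0 a b = edge0 b a.
Proof. by rewrite /edge0 adj_sym [X in _ || (_ && X)]andbC. Qed.

Context (v : vert T0).
Hypothesis v_root : self_loop T0 -> v = tree_root T0.

(** Without a self-loop any vertex [v] can serve as the root of the growth; with one, [v_root]
    forces [v] to be the vertex that carries it. *)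
Definition root_edges : {fset V * V} :=
  if self_loop T0 then [fset (inl v, inl v)]%fset else fset0.

Lemma root_edges_loop e : e \in root_edges -> e = (inl v, inl v).
Proof. by rewrite /root_edges; case: self_loop; rewrite inE// => /eqP. Qed.

(** Two neighbours of [b] in [A] are joined by a path inside [A], which [b] closes to a cycle;
    acyclicity makes that path trivial. *)
Lemma unique_attachment (A : {set vert T0}) (a a' b : vert T0) :
  grown (inl v) root_edges (induced_graph A) ->
  a \in A -> a' \in A -> b \notin A -> adj a b -> adj a' b -> a = a'.
Proof.
move=> gA aA a'A bA ab a'b.
pose eA := [rel x y | [&& adj x y, x \in A & y \in A]].
(* [Z] is reachability from [a] by tree edges inside [A]; crossing the self-loop does not change the
   vertex. *)
have [||||z [<-]] := grown_connected
    (Z := fun p => exists2 z, p = inl z & connect eA a z) gA _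
    (a := inl a) (b := inl a').
- move=> p q pq [z pz az]; move: pq; rewrite pz mem_induced_edges.
  case: q => [z'|//] /and3P[zA z'A].
  case/orP => [zz'|/and3P[_ /eqP zr /eqP z'r]].
    by exists z' => //; apply: connect_trans az (connect1 _); rewrite /= zz' zA.
  by exists z' => //; rewrite z'r -zr.
- by rewrite mem_induced_vertices.
- by rewrite mem_induced_vertices.
- by exists a.
case/connectP => p0 /shortenP[p pathp uniqp _] {p0} a'E.
have pA : {subset p <= A}.
  apply/allP.
  elim: (p) (a) pathp => //= y q IH c /andP[/and3P[_ _ yA] /IH ->].
  by rewrite yA.
have adjp : path (@adj T0) a p.
  by apply: sub_path pathp => x y /= /and3P[].
have bp : b \notin a :: p.
  rewrite inE negb_or; apply/andP; split; first by apply: contraNneq bA => ->.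
  by apply: contra bA; exact: pA.
(* A simple cycle has at most two vertices, and [b], [a] are two already, so [p] is empty. *)
have /adj_acyclic : ucycle (@adj T0) (b :: a :: p).
  by rewrite /ucycle /= rcons_path -a'E adjp a'b adj_sym ab bp andbT.
by case: p a'E {pathp uniqp pA adjp bp}.
Qed.

(** As [v] lies in [A], the vertex [b] carries no self-loop, so its only edge within [b |: A] is the
    one to [a]. *)
Lemma induced_graphU1 (A : {set vert T0}) (a b : vert T0) :
  (forall a', a' \in A -> adj a' b -> a' = a) ->
  v \in A -> a \in A -> b \notin A -> adj a b ->
  induced_graph (b |: A) =
  attach (induced_graph A) (inl a) [fset (inl b : V)]%fset.
Proof.
move=> uab vA aA bA ab.
have neq z : z \in A -> (z == b) = false.
  by move=> zA; apply: contraNF bA => /eqP <-.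
have eb z : z \in A -> edge0 z b = (z == a).
  move=> zA; apply/orP/eqP => [[/(uab _ zA)//|/and3P[/v_root vr _ /eqP br]]|->].
    by rewrite br -vr vA in bA.
  by left.
have ebb : edge0 b b = false.
  rewrite /edge0 adj_irr /= andbb; apply/negP => /andP[/v_root vr /eqP br].
  by rewrite br -vr vA in bA.
apply: eq_graph => [p|[p q]].
  rewrite mem_vertices_attach !mem_induced_vertices inE.
  by case: p => [z|//]; rewrite !inE orbC.
rewrite mem_edges_attach !mem_induced_edges !inE.
case: p q => [z|z] [z'|z']; rewrite ?andbF//.
have inlE (y y' : vert T0) : ((inl y : V) == inl y') = (y == y') by [].
rewrite !inlE !in_setU1.
have [->|zb] := eqVneq z b; have [->|z'b] := eqVneq z' b.
- by rewrite ebb (negbTE bA) [b == a]eq_sym neq// !andbF.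
- rewrite (negbTE bA) !andbF !andbT /= edge0_sym.
  have [z'A|z'A] := boolP (z' \in A); first by rewrite eb.
  by apply/esym/negbTE; apply: contraNneq z'A => ->.
- rewrite (negbTE bA) !andbF !andbT /= orbF.
  have [zA|zA] := boolP (z \in A); first by rewrite eb.
  by apply/esym/negbTE; apply: contraNneq zA => ->.
- by rewrite !andbF !orbF.
Qed.

Lemma path_crossing (A : {set vert T0}) (a : vert T0) p : a \in A ->
  path (@adj T0) a p -> last a p \notin A ->
  exists x y, [/\ x \in A, y \notin A & adj x y].
Proof.
elim: p a => [a aA _ /=|y p IH a aA /= /andP[ay yp]]; first by rewrite aA.
have [yA|yA] := boolP (y \in A); first exact: IH.
by move=> _; exists a, y.
Qed.

(** Induction on the number of vertices missing from [A]: connectedness provides an edge leaving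
    [A], and by [unique_attachment] its outer end is attached as a leaf. *)
Lemma grown_initial_graph : grown (inl v) root_edges (initial_graph T0).
Proof.
rewrite -induced_graphT.
suff grow n (A : {set vert T0}) : #|~: A| = n -> v \in A ->
    grown (inl v) root_edges (induced_graph A) ->
    grown (inl v) root_edges (induced_graph [set: vert T0]%SET).
  apply: (grow _ [set v]%SET erefl); first by rewrite inE.
  have -> : induced_graph [set v]%SET = ([fset (inl v : V)]%fset, root_edges).
    apply: eq_graph => [p|[p q]].
      by rewrite mem_induced_vertices inE; case: p => [z|//]; rewrite !inE.
    rewrite mem_induced_edges /root_edges; case: p q => [z|z] [z'|z'];
      case: ifP => [sl|nsl]; rewrite ?inE ?xpair_eqE//= ?andbF//.
    - have inlE (y y' : vert T0) : ((inl y : V) == inl y') = (y == y') by [].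
      rewrite ?inE !inlE; have [->|//] := eqVneq z v; have [->|//] := eqVneq z' v.
      by rewrite /edge0 sl (v_root sl) !eqxx orbT.
    - apply/negbTE/negP => /and3P[/eqP -> /eqP ->].
      by rewrite /edge0 adj_irr nsl.
  exact: grown_root.
elim/ltn_ind: n A => n IH A An vA gA.
have [AT|] := eqVneq A [set: vert T0]%SET; first by rewrite -AT.
rewrite -finset.subTset => /subsetPn[z _ zA].
have /connectP[p vp zE] := adj_connected v z.
have [|a [b [aA bA ab]]] := path_crossing vA vp; first by rewrite -zE.
have uab a' : a' \in A -> adj a' b -> a' = a.
  by move=> a'A a'b; apply: unique_attachment gA _ _ bA _ _.
apply: (IH #|~: (b |: A)| _ (b |: A)) => //.
- rewrite -An; apply: proper_card; apply/properP; split.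
    by rewrite finset.setCS finset.subsetU1.
  by exists b; rewrite !inE// eqxx.
- by rewrite !inE vA orbT.
rewrite (induced_graphU1 uab)//; apply: grown_leaf => //.
  by rewrite mem_induced_vertices.
by rewrite mem_induced_vertices.
Qed.

End InitialTree.

(** * Trajectories of the walk *)

Section Trajectories.
Context (T0 : rooted_tree) (s : nat).
Local Notation V := (vertex T0).
Implicit Types (k : nat -> nat) (x : nat -> V).

Lemma eq_tree k k' x x' n : (forall i, (i < n)%N -> k i = k' i) ->
  (forall i, (i < n)%N -> x i = x' i) -> tree s k x n = tree s k' x' n.
Proof.
elim: n => //= n IH kk' xx'; rewrite kk'// xx'// IH// => i i_lt.
  by rewrite kk'// ltnW.
by rewrite xx'// ltnW.
Qed.

Lemma mem_new_leaves n m (p : V) : (p \in new_leaves T0 n m) =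
  if p is inr (n', i) then (n' == n) && (i < m)%N else false.
Proof.
apply/imfsetP/idP => [[i /=]|].
  by rewrite mem_iota add0n => /andP[_ im] ->; rewrite eqxx.
case: p => [//|[n' i]] /andP[/eqP -> im].
by exists i; rewrite //= mem_iota.
Qed.

Lemma tree_inr k x n m i : (inr (m, i) : V) \in vertices (tree s k x n) ->
  (m < n)%N.
Proof.
elim: n => [|n IH] /=.
  by case/imfsetP => a _.
case: ifP => _; last by move/IH/ltnW.
rewrite mem_vertices_attach mem_new_leaves => /orP[/IH/ltnW//|].
by case/andP => /eqP ->.
Qed.

Lemma new_leaves_fresh k x n (p : V) : p \in new_leaves T0 n (k n) ->
  p \notin vertices (tree s k x n).
Proof.
rewrite mem_new_leaves; case: p => [//|[n' i]] /andP[/eqP -> _].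
by apply/negP => /tree_inr; rewrite ltnn.
Qed.

Lemma tree_verticesS k x n (p : V) : p \in vertices (tree s k x n) ->
  p \in vertices (tree s k x n.+1).
Proof. by move=> pT /=; case: ifP => // _; rewrite mem_vertices_attach pT. Qed.

Lemma tree_edgesS k x n (e : V * V) : e \in edges (tree s k x n) ->
  e \in edges (tree s k x n.+1).
Proof. by case: e => a b eT /=; case: ifP => // _; rewrite mem_edges_attach eT. Qed.

Lemma tree_vertices_le k x n m (p : V) : (n <= m)%N ->
  p \in vertices (tree s k x n) -> p \in vertices (tree s k x m).
Proof.
move=> /subnK <-; elim: (m - n)%N => [|j IH pT]; first by rewrite add0n.
by rewrite addSn; apply: tree_verticesS; exact: IH.
Qed.

Lemma tree_edges_le k x n m (e : V * V) : (n <= m)%N ->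
  e \in edges (tree s k x n) -> e \in edges (tree s k x m).
Proof.
move=> /subnK <-; elim: (m - n)%N => [|j IH pT]; first by rewrite add0n.
by rewrite addSn; apply: tree_edgesS; exact: IH.
Qed.

(** The deterministic content of the walk. Almost every sample path satisfies it, so the
    combinatorial arguments can be made path by path. *)
Definition trajectory (x0 : vert T0) k x :=
  x 0%N = inl x0 /\
  forall n, x n.+1 \in endpoints (tree s k x n.+1) (x n).

Lemma card_imfset_le (key : unit) (K K' : choiceType) (f : K -> K')
    (p : finmempred K) (l : seq K) :
  {subset p <= l} -> (#|` imfset key f p| <= size l)%N.
Proof.
move=> pl; apply: leq_trans (leq_imfset_card _ _ _) _.
by apply: uniq_leq_size => [|y]; rewrite ?enum_finmem_uniq// enum_finmemE; exact: pl.
Qed.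

Lemma card_new_leaves n m : #|` new_leaves T0 n m| = m.
Proof.
rewrite card_imfset/=; last by move=> i j [].
by rewrite -[RHS](size_iota 0) /enum_finmem /= undup_id ?iota_uniq.
Qed.

(** The factor 2 is due to each leaf edge being stored as two ordered pairs. *)
Lemma card_tree_edges k x n : (#|` edges (tree s k x n)| <=
  #|` edges (initial_graph T0)| + 2 * \sum_(0 <= i < n | s %| i) k i)%N.
Proof.
elim: n => [|n IH]; first by rewrite leq_addr.
rewrite big_mkcond big_nat_recr//= -big_mkcond/=.
case: ifP => sn; last by rewrite addn0.
have card_leaf_edges (g : V -> V * V) :
    (#|` [fset g y | y in new_leaves T0 n (k n)]%fset| <= k n)%N.
  rewrite -[leqRHS](card_new_leaves n).
  exact: (@card_imfset_le _ _ _ _ _ (enum_fset (new_leaves T0 n (k n)))).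
rewrite /attach /edges /=.
apply: leq_trans (leq_card_fsetU _ _).1 _.
rewrite mulnDr addnA (mul2n (k n)) -addnn addnA.
apply: leq_add => //; apply: leq_trans (leq_card_fsetU _ _).1 _.
exact: leq_add.
Qed.

Lemma card_endpoints (G : graph V) (a : V) :
  (#|` endpoints G a| <= #|` edges G|)%N.
Proof. apply: (@card_imfset_le _ _ _ _ _ (enum_fset (edges G))) => e.
by rewrite inE => /andP[]. Qed.

Section Trajectory.
Context (v x0 : vert T0) (k : nat -> nat) (x : nat -> V).
Hypothesis v_root : self_loop T0 -> v = tree_root T0.
Hypothesis kx : trajectory x0 k x.
Local Notation T := (tree s k x).
Local Notation grownv := (grown (inl v : V) (root_edges v)).
Local Notation E0v := (@root_edges_loop T0 v).

Lemma grown_tree_mem n : grownv (T n) /\ x n \in vertices (T n).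
Proof.
case: kx => x_0 x_next; elim: n => [|n [gT xT]].
  rewrite x_0; split; first exact: grown_initial_graph.
  by apply/imfsetP; exists x0.
have gT' : grownv (T n.+1).
  rewrite /=; case: ifP => // _; apply: grown_attach => // p.
  exact: new_leaves_fresh.
split=> //; have := x_next n; rewrite mem_endpoints.
by move=> /(grown_edge_vertices E0v gT')/andP[].
Qed.

Lemma grown_tree n : grownv (T n). Proof. by case: (grown_tree_mem n). Qed.

Lemma traj_mem n m : (n <= m)%N -> x n \in vertices (T m).
Proof. by move=> nm; apply: tree_vertices_le nm _; case: (grown_tree_mem n). Qed.

Lemma traj_edge n m : (n < m)%N -> (x n, x n.+1) \in edges (T m).
Proof.
by move=> nm; apply: tree_edges_le nm _; rewrite -mem_endpoints; case: kx.
Qed.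

Definition crosses_io (a b : V) :=
  forall N, exists2 n, (N <= n)%N & x n = a /\ x n.+1 = b.

(** An edge other than the self-loop is a bridge: between two crossings from [a] to [b] the walker
    returns to the side of [a], which is possible only from [b] to [a]. *)
Lemma crosses_io_sym n a b : (a, b) \in edges (T n) ->
  crosses_io a b -> crosses_io b a.
Proof.
move=> abT ab N; have [eab|neab] := eqVneq a b; first by rewrite -eab in ab *.
have [n1 Nn1 [xa xb]] := ab (maxn N n); have [n2 n12 [xa2 _]] := ab n1.+2.
have abT2 : (a, b) \in edges (T n2) by apply: tree_edges_le abT; lia.
have [phi phiab phiT] := grown_bridge E0v (grown_tree n2) abT2 neab.
(* The least such [j] is the first return to the side of [a] after the crossing at [n1]; the step
   into time [j] is the one sought. *)
have : exists j, (n1 < j)%N && ((j <= n2)%N && (phi (x j) == phi a)).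
  by exists n2; rewrite leqnn xa2 eqxx !andbT; lia.
move=> /ex_minnP[j /and3P[n1j jn2 /eqP xja] jmin].
have [j' jE] : exists j', j = j'.+1 by exists j.-1; lia.
have j'n1 : (n1 < j')%N.
  have : j' != n1.
    by apply: contraNneq phiab => j'n1; move: xja; rewrite jE j'n1 xb => ->.
  lia.
have xj'a : phi (x j') != phi a.
  apply/negP => xj'a; have := jmin j'; rewrite j'n1 xj'a !andbT /=; lia.
have j'n2 : (j' < n2)%N by lia.
have := phiT _ _ (traj_edge j'n2); rewrite -jE xja xj'a => /(_ isT).
case=> [[xj' _]|[xj' xj]]; first by rewrite xj' eqxx in xj'a.
by exists j'; [lia|rewrite -jE].
Qed.

Lemma uniformly_eventually (K : choiceType) (A : {fset K})
    (P : K -> nat -> Prop) :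
  (forall p, exists M, forall n, (M <= n)%N -> P p n) ->
  exists M, forall p, p \in A -> forall n, (M <= n)%N -> P p n.
Proof.
move=> /choice[M MP]; exists (\max_(p <- A) M p)%N => p pA n le_n.
by apply/MP/(leq_trans _ le_n); exact: leq_bigmax_seq.
Qed.

Definition bicoloring (G : graph V) (chi : V -> bool) :=
  forall a b, (a, b) \in edges G -> a != b -> chi a != chi b.

(** From a vertex [y] to its neighbour [z]: [swap] turns infinitely many crossings out of [y] into
    crossings from [y] to [z], and symmetry gives crossings out of [z]. *)
Lemma crosses_io_everywhere :
  (forall n a b c, (a, b) \in edges (T n) -> crosses_io a c -> crosses_io a b) ->
  forall a c, crosses_io a c ->
  forall n p, p \in vertices (T n) -> exists q, crosses_io p q.
Proof.
move=> swap a c ac n p pT.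
have [m _ [xm _]] := ac 0%N.
have aT : a \in vertices (T (maxn n m)) by rewrite -xm; apply: traj_mem; lia.
have {}pT : p \in vertices (T (maxn n m)) by apply: tree_vertices_le pT; lia.
apply: (grown_connected (Z := fun z => exists q, crosses_io z q)
  (grown_tree _) _ aT pT); last by exists c.
move=> y z yz [q yq]; exists y.
by apply: (crosses_io_sym yz); exact: swap yz yq.
Qed.

Hypothesis s_even : ~~ odd s.

(* Once the self-loop is no longer crossed, the vertices visited at even times
   keep one colour of the bipartite tree, whereas new leaves get the other one;
   so new leaves stay leaves. *)
Lemma even_time_coloring N : ~~ odd N ->
  (forall n, (N <= n)%N -> x n = inl v -> x n.+1 <> inl v) ->
  forall n, (N <= n)%N -> exists chi, [/\ bicoloring (T n) chi,
    chi (x n) = odd n,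
    forall z, z \in vertices (T n) -> z \notin vertices (T N) -> chi z
    & forall z y y', z \notin vertices (T N) ->
        (z, y) \in edges (T n) -> (z, y') \in edges (T n) -> y = y'].
Proof.
move=> oddN no_loop n /subnK <-; elim: (n - N)%N => [|j IH] {n}.
  have [chi chiT] := grown_bicolored E0v (grown_tree N).
  (* Normalised so that [x N], at the even time [N], has colour [false]. *)
  exists (fun z => chi z (+) chi (x N)); split.
  - by move=> a b abT ab; have := chiT _ _ abT ab; do 3!case: (chi _).
  - by rewrite add0n addbb (negbTE oddN).
  - by move=> z; rewrite add0n => ->.
  - move=> z y y' zN /(grown_edge_vertices E0v (grown_tree _))/andP[].
    by rewrite add0n (negbTE zN).
set n := (j + N)%N in IH *; rewrite addSn -/n.
case: IH => chi [chiT chix chinew newleaf].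
have Nn : (N <= n)%N by rewrite leq_addl.
have next_neq : x n != x n.+1.
  apply/eqP => xx; have := traj_edge (ltnSn n); rewrite -xx.
  move=> /(grown_self_loop E0v (grown_tree n.+1)) xv.
  by apply: (no_loop n) => //; rewrite -xx.
suff [chi' [chiT' chix' chinew' newleaf']] : exists chi, [/\ bicoloring (T n.+1) chi,
    chi (x n) = odd n,
    forall z, z \in vertices (T n.+1) -> z \notin vertices (T N) -> chi z
    & forall z y y', z \notin vertices (T N) ->
        (z, y) \in edges (T n.+1) -> (z, y') \in edges (T n.+1) -> y = y'].
  exists chi'; split => //.
  have := chiT' _ _ (traj_edge (ltnSn n)) next_neq; rewrite chix' /=.
  by case: (odd n) (chi' _) => [] [].
rewrite /=; case: ifP => sn; last by exists chi.
have [gT xT] := grown_tree_mem n.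
(* Leaves only appear at multiples of [s], hence at even times. The walker then has colour [false],
   so it stands on a vertex of [T N], all newer vertices being [true]. *)
have oddn : odd n = false by apply: contraNF s_even; exact: dvdn_odd.
have xTN : x n \in vertices (T N).
  by apply: contraFT oddn => /(chinew _ xT); rewrite -chix.
pose L := new_leaves T0 n (k n).
have freshL p : p \in L -> p \notin vertices (T n) by exact: new_leaves_fresh.
have oldL p : p \in vertices (T n) -> (p \in L) = false.
  by move=> pT; apply/negbTE; apply: contraL pT; exact: freshL.
exists (fun z => (z \in L) || chi z); split.
- move=> a b; rewrite mem_edges_attach => /or3P[abT|/andP[/eqP -> bL]|/andP[/eqP -> aL]].
  + have /andP[aT bT] := grown_edge_vertices E0v gT abT.
    by rewrite !oldL//=; exact: chiT.
  + by rewrite -/L in bL; rewrite bL oldL//= chix oddn.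
  + by rewrite -/L in aL; rewrite aL oldL//= chix oddn.
- by rewrite oldL.
- move=> z; rewrite mem_vertices_attach => /orP[zT|zL] zTN.
    by rewrite (chinew z)// orbT.
  by rewrite -/L in zL; rewrite zL.
- move=> z y y' zTN; rewrite !mem_edges_attach -/L.
  have zx : (z == x n) = false by apply: contraNF zTN => /eqP ->.
  rewrite zx /=.
  have [zL|zL] := boolP (z \in L); last by rewrite !andbF !orbF; exact: newleaf.
  have noT p : ((z, p) \in edges (T n)) = false.
    by rewrite (grown_fresh_edge E0v _ gT)// freshL.
  by rewrite !noT /= !andbT => /eqP -> /eqP ->.
Qed.

(** At even times after [N] the walker stays in the finite set of vertices of [T N], so some [p]
    recurs at even times. Eventually no step leads from [p] to a vertex of [T N]; each leads to a
    newer vertex, whose only neighbour is [p]. *)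
Lemma trapped_if_no_crosses_io : (forall a b, ~ crosses_io a b) ->
  exists2 t, ~~ odd t & forall m, x (t + 2 * m)%N = x t.
Proof.
move=> noc.
have eventually_not a b : exists M, forall n, (M <= n)%N -> x n = a -> x n.+1 <> b.
  have /existsNP[M noM] := noc a b; exists M => n Mn xa xb.
  by apply: noM; exists n.
have [N0 no_loop0] := eventually_not (inl v) (inl v).
pose N := N0.*2.
have oddN : ~~ odd N by rewrite odd_double.
have no_loop n : (N <= n)%N -> x n = inl v -> x n.+1 <> inl v.
  by move=> Nn; apply: no_loop0; rewrite /N in Nn; lia.
have color := even_time_coloring oddN no_loop.
have evenTN n : (N <= n)%N -> ~~ odd n -> x n \in vertices (T N).
  move=> Nn oddn; have [chi [_ chix chinew _]] := color _ Nn.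
  apply: contraNT oddn => xTN; rewrite -chix; apply: chinew => //.
  exact: traj_mem.
have [p pio] : exists p, forall M, exists2 n, (M <= n)%N & ~~ odd n /\ x n = p.
  apply: contrapT => /forallNP nop.
  have [|M MP] := @uniformly_eventually _ (vertices (T N))
    (fun p n => ~~ odd n -> x n <> p).
    move=> p; have /existsNP[M noM] := nop p; exists M => n Mn oddn xp.
    by apply: noM; exists n.
  have Nn : (N <= (N + M).*2)%N by lia.
  have oddn : ~~ odd (N + M).*2 by rewrite odd_double.
  by apply: (MP _ (evenTN _ Nn oddn) (N + M).*2) => //; lia.
have [M noM] := uniformly_eventually (vertices (T N)) (eventually_not p).
have [t Mt [oddt xt]] := pio (maxn N M).
exists t => // m; rewrite xt; elim: m => [|m IH]; first by rewrite muln0 addn0.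
pose n := (t + 2 * m)%N.
have -> : (t + 2 * m.+1)%N = n.+2 by rewrite /n; lia.
have xn1 : x n.+1 \notin vertices (T N).
  by apply/negP => xTN; apply: (noM _ xTN n _ IH) => //; rewrite /n; lia.
have [|chi [_ _ _ leaf]] := color n.+2; first by rewrite /n; lia.
apply/esym/(leaf _ _ _ xn1); last exact: traj_edge.
apply: (grown_sym E0v (grown_tree _)).
by rewrite -[p]IH; exact: traj_edge.
Qed.

End Trajectory.
End Trajectories.

(** * Discounted crossing potentials *)

Section Supersolution.
Context (R : realFieldType) (V : choiceType) (v w : V) (beta : R).
Hypothesis beta_gt0 : 0 < beta.
Hypothesis beta_le1 : beta <= 1.
Implicit Types (G : graph V) (U : V -> R).

Definition payoff U (x y : V) : R := if (x, y) == (v, w) then 1 else U y.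

(* U dominates x |-> E_x[beta ^ tau] for the simple random walk on G, where tau
   is the first time at which the edge (v, w) has been crossed. *)
Definition supersolution G U := forall x, x \in vertices G ->
  beta * \sum_(y <- endpoints G x) payoff U x y
    <= (#|` endpoints G x|)%:R * U x.

(** Choosing the relation as a function of the graph alone makes the potential below a function of
    the environment and the trajectory. The default [false] is for graphs that are not grown
    trees. *)
Definition chosen_descendants G : V -> V -> bool :=
  if pselect (exists D, descendants v G D) is left exD then sval (cid exD)
  else fun _ _ => false.

Lemma chosen_descendantsP G : (exists D, descendants v G D) ->
  descendants v G (chosen_descendants G).
Proof.
by rewrite /chosen_descendants; case: pselect => // exD _; case: (cid exD).
Qed.

(** The solution [r] of [1 - r = r * (u * (n * (1 - beta ^+ 2)))], which balances the supersolution
    inequality at the vertex that receives the leaves. *)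
Definition drop_factor (u : R) (n : nat) : R :=
  (1 + u * (n%:R * (1 - beta ^+ 2)))^-1.

(* Attaching n leaves to x scales U by a common factor on the descendants of
   x, so that the supersolution property only has to be checked at x. *)
Definition attach_potential G U (x : V) (n : nat) (z : V) : R :=
  if z \in vertices G then
    if chosen_descendants G x z then drop_factor (U x) n * U z else U z
  else beta * (drop_factor (U x) n * U x).

Variables (E0 : {fset V * V}) (G : graph V) (U : V -> R) (x : V) (L : {fset V}).
Hypothesis E0_loop : forall e, e \in E0 -> e = (v, v).
Hypothesis gG : grown v E0 G.
Hypothesis U01 : forall z, 0 < U z <= 1.
Hypothesis xG : x \in vertices G.
Local Notation n := (#|` L|).

Lemma beta2_le1 : 0 <= 1 - beta ^+ 2.
Proof. by rewrite subr_ge0 expr_le1// ltW. Qed.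

Lemma drop_factor_gt0_le1 m : 0 < drop_factor (U x) m <= 1.
Proof.
have /andP[Ux _] := U01 x.
have den : 1 <= 1 + U x * (m%:R * (1 - beta ^+ 2)).
  by rewrite lerDl mulr_ge0 ?mulr_ge0 ?beta2_le1// ltW.
by rewrite invr_gt0 invf_le1 ?den ?(lt_le_trans ltr01 den).
Qed.

Lemma attach_potential01 m z : 0 < attach_potential G U x m z <= 1.
Proof.
have /andP[r0 r1] := drop_factor_gt0_le1 m; rewrite /attach_potential.
have /andP[Uz0 Uz1] := U01 z; have /andP[Ux0 Ux1] := U01 x.
case: ifP => _; last first.
  by rewrite !mulr_gt0//= mulr_ile1 ?mulr_ile1 ?mulr_ge0// ltW.
case: ifP => _; last exact: U01.
by rewrite mulr_gt0//= mulr_ile1// ltW.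
Qed.

Hypothesis wG : w \in vertices G.
Hypothesis freshL : forall y, y \in L -> y \notin vertices G.
Hypothesis superU : supersolution G U.
Local Notation D := (chosen_descendants G).
Local Notation U' := (attach_potential G U x n).
Local Notation rho := (drop_factor (U x) n).
Local Notation d := (#|` endpoints G x|).

Let DG : descendants v G D.
Proof. exact: chosen_descendantsP (grown_descendants E0_loop gG). Qed.

Let neighborG a b : b \in endpoints G a -> b \in vertices G.
Proof. by rewrite mem_endpoints => /(grown_edge_vertices E0_loop gG)/andP[]. Qed.

Lemma perm_endpoints_attach :
  perm_eq (endpoints (attach G x L) x) (endpoints G x ++ L).
Proof.
apply: uniq_perm => [||y]; first exact: fset_uniq.
  rewrite cat_uniq !fset_uniq andbT; apply/hasPn => y yL.
  by apply/negP => /neighborG; rewrite (negbTE (freshL yL)).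
have xL : x \in L = false by apply: contraTF xG; exact: freshL.
by rewrite mem_cat !mem_endpoints mem_edges_attach eqxx xL andbF orbF.
Qed.

Lemma endpoints_attach_neq a : a \in vertices G -> a != x ->
  endpoints (attach G x L) a = endpoints G a.
Proof.
move=> aG ax; apply/fsetP => y.
have aL : a \in L = false by apply: contraTF aG; exact: freshL.
by rewrite !mem_endpoints mem_edges_attach (negbTE ax) aL andbF !orbF.
Qed.

Lemma endpoints_attach_leaf a : a \in L ->
  endpoints (attach G x L) a = [fset x]%fset.
Proof.
move=> aL; apply/fsetP => y; have aG := freshL aL.
rewrite mem_endpoints mem_edges_attach (grown_fresh_edge E0_loop _ gG aG) aL andbT inE.
by rewrite [a == x]eq_sym (fresh_neq aG).
Qed.

(* The parent of x, or w if x = v. *)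
Definition unscaled (y : V) : bool := ((x, y) == (v, w)) || ~~ D x y.

(** Neighbours below [x] are scaled by [rho]. The exceptional neighbour is not, and as its payoff is
    at most 1 the error is at most [1 - rho]. *)
Lemma payoff_old_attach y : y \in endpoints G x ->
  payoff U' x y <= rho * payoff U x y + (1 - rho) * (unscaled y)%:R.
Proof.
move=> yx; have yG := neighborG yx; have /andP[r0 r1] := drop_factor_gt0_le1 n.
rewrite /payoff /attach_potential /unscaled yG; case: eqP => _ /=; first lra.
have /andP[Uy0 Uy1] := U01 y; case: ifP => _ /=; first lra.
have : (1 - rho) * U y <= (1 - rho) by rewrite ler_piMr// subr_ge0.
lra.
Qed.

(** At the root every vertex is a descendant, which leaves only [w]; elsewhere only the parent
    qualifies. *)
Lemma unscaled_uniq a b : a \in endpoints G x -> b \in endpoints G x ->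
  unscaled a -> unscaled b -> a = b.
Proof.
case: DG => Drefl _ Duniq _ aG bG; rewrite /unscaled !xpair_eqE.
have [xv|xv] := eqVneq x v => /=.
  have Dx c : c \in endpoints G x -> D x c by rewrite xv => /neighborG/Drefl[].
  by rewrite !Dx// !orbF => /eqP -> /eqP ->.
by apply: Duniq; rewrite -mem_endpoints.
Qed.

Lemma sum_unscaled : \sum_(y <- endpoints G x) (unscaled y)%:R <= 1 :> R.
Proof.
rewrite -natr_sum lern1.
have -> : (\sum_(y <- endpoints G x) unscaled y =
    size [seq y <- endpoints G x | unscaled y])%N.
  by rewrite size_filter -sum1_count [RHS]big_mkcond; apply: eq_bigr => y; case: unscaled.
have := seq.filter_uniq unscaled (fset_uniq (endpoints G x)).
have : {in seq.filter unscaled (endpoints G x) &, forall a b, a = b}.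
  move=> a b; rewrite !mem_filter => /andP[sa aG] /andP[sb bG].
  exact: unscaled_uniq.
case: (seq.filter _ _) => [//|a [//|b l]] ab /= /andP[].
by rewrite (ab a b) ?inE ?eqxx ?orbT.
Qed.

(** At a new leaf equality holds. At old vertices other than [x], both sides scale by [rho] below
    [x], and payoffs can only decrease elsewhere. At [x] the leaves compensate for the one unscaled
    neighbour. *)
Lemma supersolution_attach : supersolution (attach G x L) U'.
Proof.
have /andP[r0 r1] := drop_factor_gt0_le1 n; have /andP[Ux0 Ux1] := U01 x.
have [Drefl Dcut _ Droot] := DG.
have U'x : U' x = rho * U x by rewrite /attach_potential xG (Drefl _ xG).1.
move=> z; rewrite mem_vertices_attach => /orP[zG|zL]; last first.
  rewrite endpoints_attach_leaf// big_seq_fset1 cardfs1 mul1r.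
  have zG := freshL zL.
  rewrite /payoff xpair_eqE.
  have -> : (z == v) = false.
    by apply: contraNF zG => /eqP ->; exact: grown_mem_root gG.
  by rewrite U'x /attach_potential (negbTE zG).
have [->|zx] := eqVneq z x; last first.
  rewrite endpoints_attach_neq//.
  have [Dz|Dz] := boolP (D x z); last first.
    rewrite {2}/attach_potential zG (negbTE Dz).
    apply: le_trans (superU zG); rewrite ler_wpM2l ?(ltW beta_gt0)//.
    rewrite big_seq [leRHS]big_seq; apply: ler_sum => y yz.
    rewrite /payoff; case: ifP => // _; rewrite /attach_potential (neighborG yz).
    by case: ifP => // _; rewrite ler_piMl// ltW//; case/andP: (U01 y).
  rewrite {2}/attach_potential zG Dz.
  (* A proper descendant of [x] is not the root, so it never earns the payoff 1, and all its
     neighbours descend from [x]. *)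
  have -> : \sum_(y <- endpoints G z) payoff U' z y =
      rho * \sum_(y <- endpoints G z) payoff U z y.
    rewrite mulr_sumr; apply: eq_big_seq => y yz; rewrite /payoff xpair_eqE.
    have -> /= : (z == v) = false.
      apply/negbTE; apply: contra_neq zx => zv; apply/esym.
      by rewrite zv; apply: Droot; rewrite // -zv.
    rewrite /attach_potential (neighborG yz).
    have -> // : D x y.
    apply: contraTT isT => nDy; case/eqP: zx; apply: Dcut Dz nDy => //.
    by rewrite -mem_endpoints.
  by rewrite [leLHS]mulrCA [leRHS]mulrCA ler_wpM2l ?(ltW r0)//; exact: superU.
rewrite (perm_big _ perm_endpoints_attach) (perm_size perm_endpoints_attach).
rewrite big_cat size_cat /= U'x.
have le_old : \sum_(y <- endpoints G x) payoff U' x y <=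
    rho * \sum_(y <- endpoints G x) payoff U x y + (1 - rho).
  apply: (@le_trans _ _ (\sum_(y <- endpoints G x)
      (rho * payoff U x y + (1 - rho) * (unscaled y)%:R))).
    by rewrite big_seq [leRHS]big_seq; apply: ler_sum => y; exact: payoff_old_attach.
  rewrite big_split/= -!mulr_sumr lerD2l ler_piMr ?subr_ge0//.
  exact: sum_unscaled.
have -> : \sum_(y <- L) payoff U' x y = n%:R * (beta * (rho * U x)).
  rewrite (@eq_big_seq _ _ _ _ _ _ (fun=> beta * (rho * U x))).
    by rewrite big_const_seq count_predT iter_addr_0 mulr_natl.
  move=> y /freshL yG; rewrite /payoff xpair_eqE.
  have -> : (y == w) = false by apply: contraNF yG => /eqP ->.
  by rewrite andbF /attach_potential (negbTE yG).
have superx := superU xG.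
(* The defining identity of [rho]: the right side is what the leaves gain, their potential being
   smaller by the factor [beta] and discounted once more. *)
have rhoE : 1 - rho = rho * (U x * (n%:R * (1 - beta ^+ 2))).
  have den0 : 1 + U x * (n%:R * (1 - beta ^+ 2)) != 0.
    by move: r0; rewrite invr_gt0 => /gt_eqF ->.
  by rewrite /drop_factor; field.
move: superx le_old; set S := \sum_(_ <- _) payoff U x _.
set S' := \sum_(_ <- _) payoff U' x _ => superx le_old.
have h1 : beta * S' <= beta * (rho * S + (1 - rho)) by rewrite ler_wpM2l// ltW.
have h2 : rho * (beta * S) <= rho * (d%:R * U x) by rewrite ler_wpM2l// ltW.
have h3 : beta * (1 - rho) <= 1 - rho by rewrite ler_piMl// subr_ge0.
rewrite natrD; move: h1 h2 h3 rhoE.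
move: (n%:R : R) (d%:R : R) => m e h1 h2 h3 rhoE; nra.
Qed.

End Supersolution.

(** * The potential along a trajectory and its deterministic rate *)

Section Potential.
Context (R : realFieldType) (T0 : rooted_tree) (s : nat) (v w : vert T0) (beta : R).
Hypothesis beta_gt0 : 0 < beta.
Hypothesis beta_le1 : beta <= 1.
Local Notation V := (vertex T0).
Implicit Types (k : nat -> nat) (x : nat -> V).

Fixpoint potential k x n : V -> R :=
  if n is m.+1 then
    if (s %| m)%N then
      @attach_potential R V (inl v) beta (tree s k x m) (potential k x m) (x m) (k m)
    else potential k x m
  else fun=> 1.

Lemma eq_potential k k' x x' n : (forall i, (i < n)%N -> k i = k' i) ->
  (forall i, (i < n)%N -> x i = x' i) -> potential k x n = potential k' x' n.
Proof.
elim: n => //= n IH kk' xx'; rewrite kk'// xx'// IH; first last.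
- by move=> i i_lt; rewrite xx'// ltnW.
- by move=> i i_lt; rewrite kk'// ltnW.
rewrite (@eq_tree _ s k k' x x')// => i i_lt.
  by rewrite kk'// ltnW.
by rewrite xx'// ltnW.
Qed.

Lemma potential01 k x n z : 0 < potential k x n z <= 1.
Proof.
elim: n z => [|n IH] z /=; first by rewrite ltr01 lexx.
by case: ifP => // _; exact: attach_potential01.
Qed.

Definition delta k n : R :=
  if (s %| n)%N then (k n)%:R * (1 - beta ^+ 2) else 0.

(* The conditional expectation of the discounted potential at the walker, given
   the environment, is dominated by this recursion. *)
Fixpoint rate k n : R :=
  if n is m.+1 then beta^-1 * (rate k m / (1 + delta k m * rate k m)) else 1.

Lemma eq_delta k k' n : k n = k' n -> delta k n = delta k' n.
Proof. by rewrite /delta => ->. Qed.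

Lemma eq_rate k k' n : (forall i, (i < n)%N -> k i = k' i) ->
  rate k n = rate k' n.
Proof.
elim: n => //= n IH kk'; rewrite IH => [|i i_lt]; last by rewrite kk'// ltnW.
by rewrite (@eq_delta k k')// kk'.
Qed.

Lemma delta_ge0 k n : 0 <= delta k n.
Proof. by rewrite /delta; case: ifP => // _; rewrite mulr_ge0// beta2_le1. Qed.

Lemma rate_gt0 k n : 0 < rate k n.
Proof.
elim: n => //= n IH; rewrite mulr_gt0 ?invr_gt0// divr_gt0//.
by rewrite ltr_wpDr// mulr_ge0 ?delta_ge0// ltW.
Qed.

(** The inverse satisfies [1 / rate k n.+1 = beta * (1 / rate k n + delta k n)]; replacing every
    later discount by [beta ^+ n] gives the bound. *)
Lemma rate_le k n :
  rate k n <= (beta ^+ n)^-1 / (1 + \sum_(0 <= i < n) delta k i).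
Proof.
elim: n => [|n IH]; first by rewrite big_geq// expr0 addr0 !invr1 mulr1.
rewrite /= big_nat_recr//= addrA; set S := 1 + _ in IH *.
have S1 : 1 <= S by rewrite lerDl sumr_ge0// => i _; exact: delta_ge0.
have S0 : 0 < S by exact: lt_le_trans S1.
have r0 := rate_gt0 k n; have d0 := delta_ge0 k n.
rewrite exprS invfM -mulrA ler_wpM2l ?invr_ge0 ?(ltW beta_gt0)//.
set b := (beta ^+ n)^-1 in IH *.
have b1 : 1 <= b by rewrite /b invf_ge1 ?exprn_gt0// exprn_ile1// ltW.
have den : 0 < 1 + delta k n * rate k n by rewrite ltr_wpDr// mulr_ge0// ltW.
rewrite ler_pdivrMr// mulrAC ler_pdivlMr; last by rewrite ltr_wpDr.
move: IH; rewrite ler_pdivlMr// => IH.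
have : delta k n * rate k n <= b * (delta k n * rate k n).
  by rewrite ler_peMl// mulr_ge0// ltW.
move: (rate k n) (delta k n) => r dl in IH *; nra.
Qed.

Section Trajectory.
Context (x0 : vert T0) (k : nat -> nat) (x : nat -> V).
Hypothesis v_root : self_loop T0 -> v = tree_root T0.
Hypothesis kx : trajectory s x0 k x.
Local Notation T := (tree s k x).

Lemma supersolution_potential n :
  @supersolution R V (inl v) (inl w) beta (T n) (potential k x n).
Proof.
elim: n => [a _|n IH].
  rewrite /potential; under eq_bigr do rewrite /payoff if_same.
  by rewrite big_const_seq count_predT iter_addr_0 mulr1 ler_piMl.
rewrite /=; case: ifP => // _.
have [gT xT] := grown_tree_mem v_root kx n.
have := supersolution_attach (L := new_leaves T0 n (k n)) beta_gt0 beta_le1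
  (@root_edges_loop T0 v) gT _ xT _ _ IH.
rewrite card_new_leaves; apply.
- by move=> z; exact: potential01.
- by apply: (tree_vertices_le (n := 0%N)) => //; apply/imfsetP; exists w.
- by move=> y; exact: new_leaves_fresh.
Qed.

Lemma potential_growth n : potential k x n.+1 (x n) =
  potential k x n (x n) / (1 + delta k n * potential k x n (x n)).
Proof.
have [gT xT] := grown_tree_mem v_root kx n.
rewrite /= /delta; case: ifP => _; last by rewrite mul0r addr0 divr1.
have /chosen_descendantsP[Drefl _ _ _] := grown_descendants (@root_edges_loop T0 v) gT.
rewrite /attach_potential xT (Drefl _ xT).1 /drop_factor mulrC.
by rewrite [in X in X^-1]mulrC.
Qed.

(** The map from [u] to [u / (1 + delta * u)] is concave, and the right side is its tangent at [r].
    Being affine in the potential, the bound can be integrated; after clearing denominators the gap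
    is [delta * (r - u) ^+ 2]. *)
Lemma potential_growth_le n r : 0 <= r ->
  potential k x n.+1 (x n) <=
  (delta k n * r ^+ 2 + potential k x n (x n)) / (1 + delta k n * r) ^+ 2.
Proof.
move=> r0; rewrite potential_growth; have d0 := delta_ge0 k n.
have /andP[u0 _] := potential01 k x n (x n).
move: (potential _ _ _ _) (delta _ _) u0 d0 => u dl u0 d0.
rewrite ler_pdivrMr; last by rewrite ltr_wpDr// mulr_ge0// ltW.
rewrite mulrAC ler_pdivlMr; last by rewrite exprn_gt0// ltr_wpDr// mulr_ge0.
have : 0 <= dl * (r - u) ^+ 2 by rewrite mulr_ge0// sqr_ge0.
nra.
Qed.

End Trajectory.
End Potential.

(** * The Markov property along countable histories *)

Section Discrete.
Context (R : realType) (d : measure_display) (Omega : measurableType d)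
  (P : probability Omega R) (C : countType) (H : Omega -> C).
Hypothesis mH : forall c, measurable (H @^-1` [set c]).

Lemma measurable_discrete_preimage (A : set C) : measurable (H @^-1` A).
Proof.
rewrite [X in measurable X](_ : _ = \bigcup_(c in [set: C]) (H @^-1` ([set c] `&` A))).
  apply: countable_bigcupT_measurable => // c.
  have [Ac|nAc] := pselect (A c).
    by rewrite (_ : [set c] `&` A = [set c])//; apply/seteqP; split=> [z []|z ->].
  rewrite (_ : [set c] `&` A = set0) ?preimage_set0//.
  by apply/seteqP; split=> // z [->].
apply/seteqP; split=> [w Aw|w [c _ []]//].
by exists (H w).
Qed.

Lemma measurable_discrete d' (T : sigmaRingType d') (f : C -> T) :
  measurable_fun setT (fun w => f (H w)).
Proof.
by move=> _ Y _; rewrite setTI; exact: (measurable_discrete_preimage (f @^-1` Y)).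
Qed.

Local Open Scope ereal_scope.

Lemma integral_discrete (f : C -> \bar R) : (forall c, 0 <= f c) ->
  \int[P]_w f (H w) = \esum_(c in [set: C]) (f c * P (H @^-1` [set c])).
Proof.
move=> f0; pose F (n : nat) := H @^-1` [set c : C | choice.pickle c = n].
have mF n : measurable (F n) by exact: measurable_discrete_preimage.
have FT : \bigcup_n F n = setT.
  by apply/seteqP; split=> // w _; exists (choice.pickle (H w)).
rewrite -FT ge0_integral_bigcup//; first last.
- apply/trivIsetP => i j _ _ ij; apply/seteqP; split=> // w [/= wi wj].
  by move: ij; rewrite -wi -wj eqxx.
- by rewrite [X in measurable_fun X _]FT; exact: measurable_discrete.
pose a n := if pickle_inv n is Some c then f c * P (H @^-1` [set c]) else 0.
have aE n : \int[P]_(w in F n) f (H w) = a n.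
  rewrite /a; case E : (pickle_inv n) => [c|].
    have cn : choice.pickle c = n by have := @pickle_invK C n; rewrite E.
    have FE : F n = H @^-1` [set c].
      apply/seteqP; split=> w; rewrite /F /= -cn; last by move=> ->.
      exact: (pcan_inj choice.pickleK).
    rewrite FE -integral_cst//; apply: eq_integral => w.
    by rewrite inE => /= ->.
  rewrite (_ : F n = set0) ?integral_set0//.
  apply/seteqP; split=> // w; rewrite /F /= => wn.
  by have := @pickleK_inv C (H w); rewrite wn E.
have a0 n : 0 <= a n by rewrite /a; case: pickle_inv => // c; rewrite mule_ge0.
rewrite (eq_eseriesr (fun n _ => aE n)) nneseries_esumT//.
transitivity (\esum_(n in range (@choice.pickle C)) a n).
  rewrite [RHS]esum_mkcond; apply: eq_esum => n _; case: ifPn => // /negP nr.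
  rewrite /a; case E : (pickle_inv n) => [c|//]; exfalso; apply: nr.
  by rewrite inE; exists c => //; have := @pickle_invK C n; rewrite E.
rewrite esum_image; last by move=> x y _ _ /(pcan_inj choice.pickleK).
by apply: eq_esum => c _; rewrite /a pickleK_inv.
Qed.

End Discrete.

Section MarkovProperty.
Context (R : realType) (s : nat) (T0 : rooted_tree) (x0 : vert T0)
  (d : measure_display) (Omega : measurableType d) (P : probability Omega R)
  (xi : nat -> {RV P >-> nat}) (X : nat -> Omega -> vertex T0).
Hypothesis hX : is_TBRW s x0 xi X.
Local Notation V := (vertex T0).

(** Both indices are inclusive. An adapted functional depends on a finite history, which takes
    countably many values, so its measurability and its integral reduce to countable unions and
    sums. *)
Definition adapted (U : Type) m n (F : (nat -> nat) -> (nat -> V) -> U) :=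
  forall k k' x x', (forall i, (i <= m)%N -> k i = k' i) ->
    (forall i, (i <= n)%N -> x i = x' i) -> F k x = F k' x'.

Definition history m n w : seq nat * seq V :=
  (mkseq (xi ^~ w) m.+1, mkseq (X ^~ w) n.+1).

Lemma measurable_xi i (A : set nat) : measurable (xi i @^-1` A).
Proof. by rewrite -[X in measurable X]setTI; apply: measurable_funP. Qed.

Lemma measurable_X i (A : set V) : measurable (X i @^-1` A).
Proof. by case: hX. Qed.

Definition cylinder m n (k : nat -> nat) (x : nat -> V) : set Omega :=
  [set w | (forall i, (i <= m)%N -> xi i w = k i) /\
           (forall i, (i <= n)%N -> X i w = x i)].

Lemma history_fiber m n c : history m n @^-1` [set c] =
  if (size c.1 == m.+1) && (size c.2 == n.+1)
  then cylinder m n (nth 0%N c.1) (nth (inl x0) c.2) else set0.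
Proof.
case: c => k x /=; case: ifPn => [/andP[/eqP sk /eqP sx]|sz]; apply/seteqP; split=> // w.
- case=> <- <-; split=> i im; rewrite nth_mkseq//.
- case=> wk wx; congr pair.
    apply: (@eq_from_nth _ 0%N); rewrite size_mkseq// => i im.
    by rewrite nth_mkseq// wk.
  apply: (@eq_from_nth _ (inl x0)); rewrite size_mkseq// => i im.
  by rewrite nth_mkseq// wx.
- by case=> kE xE; move: sz; rewrite -kE -xE !size_mkseq !eqxx.
Qed.

Lemma measurable_cylinder m n k x : measurable (cylinder m n k x).
Proof.
apply: measurableI.
  rewrite [X in measurable X](_ : _ =
      \bigcap_(i in [set i | (i <= m)%N]) (xi i @^-1` [set k i])) //.
  by apply: bigcap_measurable => [|i _]; [exists 0%N|exact: measurable_xi].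
rewrite [X in measurable X](_ : _ =
    \bigcap_(i in [set i | (i <= n)%N]) (X i @^-1` [set x i])) //.
by apply: bigcap_measurable => [|i _]; [exists 0%N|exact: measurable_X].
Qed.

Lemma measurable_history m n c : measurable (history m n @^-1` [set c]).
Proof. by rewrite history_fiber; case: ifP => // _; exact: measurable_cylinder. Qed.

Lemma adapted_history (U : Type) m n (F : (nat -> nat) -> (nat -> V) -> U) w :
  adapted m n F -> F (xi ^~ w) (X ^~ w) =
  F (nth 0%N (history m n w).1) (nth (inl x0) (history m n w).2).
Proof. by move=> aF; apply: aF => i im; rewrite nth_mkseq. Qed.

Lemma measurable_adapted m n (F : (nat -> nat) -> (nat -> V) -> \bar R) :
  adapted m n F -> measurable_fun setT (fun w => F (xi ^~ w) (X ^~ w)).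
Proof.
move=> aF; under eq_fun do rewrite (adapted_history _ aF).
exact: (measurable_discrete (measurable_history m n)
  (fun c => F (nth 0%N c.1) (nth (inl x0) c.2))).
Qed.

Local Open Scope ereal_scope.

Lemma integral_adapted m n (F : (nat -> nat) -> (nat -> V) -> \bar R) :
  adapted m n F -> (forall k x, 0 <= F k x) ->
  \int[P]_w F (xi ^~ w) (X ^~ w) =
  \esum_(c in [set: seq nat * seq V])
    (F (nth 0%N c.1) (nth (inl x0) c.2) * P (history m n @^-1` [set c])).
Proof.
move=> aF F0; under eq_integral do rewrite (adapted_history _ aF).
exact: (integral_discrete P (measurable_history m n)
  (f := fun c => F (nth 0%N c.1) (nth (inl x0) c.2))).
Qed.

Definition step_mean (G : (nat -> nat) -> (nat -> V) -> V -> R) n k x : R :=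
  ((#|` endpoints (tree s k x n.+1) (x n)|)%:R^-1 *
   \sum_(y <- endpoints (tree s k x n.+1) (x n)) G k x y)%R.

Lemma history_step m n (c : seq nat * seq V) y : (n <= m)%N ->
  P ((history m n @^-1` [set c]) `&` (X n.+1 @^-1` [set y])) =
  P (history m n @^-1` [set c]) *
  (step_prob R (tree s (nth 0%N c.1) (nth (inl x0) c.2) n.+1)
     (nth (inl x0) c.2 n) y)%:E.
Proof.
move=> nm; rewrite history_fiber; case: ifP => _; last by rewrite set0I measure0 mul0e.
set k := nth 0%N c.1; set x := nth (inl x0) c.2.
pose x' i := if (i == n.+1)%N then y else x i.
have x'E i : (i <= n)%N -> x' i = x i by rewrite /x'; case: eqP => // ->; rewrite ltnn.
have x'y : x' n.+1 = y by rewrite /x' eqxx.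
have xx' : tree s k x' n.+1 = tree s k x n.+1 by apply: eq_tree => // i /x'E.
have [_ _ /(_ n m k x' nm)] := hX; rewrite xx' x'y x'E// => stepE.
have cylE : cylinder m n k x' = cylinder m n k x.
  by apply/seteqP; split=> w [wk wx]; split=> // i im; rewrite wx// x'E.
transitivity (P [set w | (forall i, (i <= m)%N -> xi i w = k i) /\
                      (forall i, (i <= n.+1)%N -> X i w = x' i)]).
  congr (P _); rewrite -cylE; apply/seteqP; split=> w /=.
    case=> -[wk wx] wy; split=> // i; rewrite leq_eqVlt => /orP[/eqP ->|/wx//].
    by rewrite wy /x' eqxx.
  case=> wk wx; split; first by split=> // i im; rewrite wx// ltnW.
  by rewrite wx// /x' eqxx.
by rewrite stepE -/(cylinder m n k x') cylE.
Qed.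

(** The Markov property in integrated form, in place of conditional expectations. [G] may look at
    the environment up to any [m >= n], hence also at its future. *)
Lemma integral_next m n (G : (nat -> nat) -> (nat -> V) -> V -> R) :
  (n <= m)%N -> adapted m n G -> (forall k x y, (0 <= G k x y)%R) ->
  \int[P]_w (G (xi ^~ w) (X ^~ w) (X n.+1 w))%:E =
  \int[P]_w (step_mean G n (xi ^~ w) (X ^~ w))%:E.
Proof.
move=> nm aG G0.
have aS : adapted m n (fun k x => (step_mean G n k x)%:E).
  move=> k k' x x' kk' xx'; rewrite /step_mean (aG k k' x x')// xx'//.
  by rewrite (@eq_tree _ s k k' x x')// => i i_lt; rewrite kk'// (leq_trans _ nm).
rewrite (integral_adapted aS); last first.
  by move=> k x; rewrite lee_fin mulr_ge0// sumr_ge0.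
pose H w := (history m n w, X n.+1 w).
have HE c y : H @^-1` [set (c, y)] =
    (history m n @^-1` [set c]) `&` (X n.+1 @^-1` [set y]).
  by apply/seteqP; split=> w /=; [case=> <- <-|case=> <- <-].
have mH cy : measurable (H @^-1` [set cy]).
  by case: cy => c y; rewrite HE; apply: measurableI;
    [exact: measurable_history|exact: measurable_X].
under eq_integral do rewrite (adapted_history _ aG).
rewrite (integral_discrete P mH
  (f := fun cy => (G (nth 0%N cy.1.1) (nth (inl x0) cy.1.2) cy.2)%:E)); last first.
  by move=> cy; rewrite lee_fin.
transitivity (\esum_(c in [set: seq nat * seq V]) \esum_(y in [set: V])
   ((G (nth 0%N c.1) (nth (inl x0) c.2) y)%:E * P (H @^-1` [set (c, y)]))).
  rewrite esum_esum; last by move=> c y _ _; rewrite mule_ge0// lee_fin.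
  rewrite (_ : _ `*`` _ = setT); last by apply/seteqP; split.
  by apply: eq_esum => -[c y].
apply: eq_esum => c _.
set k := nth 0%N c.1; set x := nth (inl x0) c.2.
set E := endpoints (tree s k x n.+1) (x n).
(* Vertices that are not endpoints have transition probability 0, so the inner sum becomes
   finite. *)
transitivity (\esum_(y in [set` E]) ((G k x y)%:E * P (H @^-1` [set (c, y)]))).
  rewrite [RHS]esum_mkcond; apply: eq_esum => y _; case: ifPn => // yE.
  rewrite HE history_step//= /step_prob -/k -/x -/E ifF ?mule0//.
  by apply/negP => yE'; move/negP: yE; apply; rewrite inE.
rewrite esum_fset//; last by move=> y _; rewrite mule_ge0// lee_fin.
rewrite fsbig_finite/=; last exact: finite_fset.
rewrite set_fsetK.
transitivity ((\sum_(y <- E) P (history m n @^-1` [set c]) *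
    ((#|` E|%:R^-1)%R%:E * (G k x y)%:E))%E).
  apply: eq_big_seq => y yE.
  rewrite HE history_step//= /step_prob -/k -/x -/E yE muleCA.
  by rewrite [X in _ * X]muleC.
rewrite -ge0_sume_distrr; last by move=> y _; rewrite mule_ge0// lee_fin.
rewrite muleC; congr (_ * _); rewrite /step_mean -/E EFinM -sumEFin.
by rewrite ge0_sume_distrr// => y _; rewrite lee_fin.
Qed.

Lemma measurable_adapted_set m n (Q : (nat -> nat) -> (nat -> V) -> Prop) :
  adapted m n Q -> measurable [set w | Q (xi ^~ w) (X ^~ w)].
Proof.
move=> aQ; have := measurable_discrete_preimage (measurable_history m n)
  [set c | Q (nth 0%N c.1) (nth (inl x0) c.2)].
congr measurable; apply/seteqP; split=> w /=; by rewrite (adapted_history w aQ).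
Qed.

(** The indicator of an illegal step has mean 0 over the legal endpoints. *)
Lemma ae_step n : {ae P, forall w,
  X n.+1 w \in endpoints (random_tree s xi X n.+1 w) (X n w)}.
Proof.
pose G k x (y : V) : R := (y \notin endpoints (tree s k x n.+1) (x n))%:R.
have aG : adapted n n G.
  move=> k k' x x' kk' xx'; apply/funext => y; rewrite /G xx'//.
  by rewrite (@eq_tree _ s k k' x x').
pose N := [set w | X n.+1 w \notin endpoints (random_tree s xi X n.+1 w) (X n w)].
have mN : measurable N.
  apply: (measurable_adapted_set (m := n) (n := n.+1)
    (Q := fun k x => x n.+1 \notin endpoints (tree s k x n.+1) (x n))).
  move=> k k' x x' kk' xx'; rewrite !xx'//.
  by rewrite (@eq_tree _ s k k' x x')// => i i_lt; rewrite xx'// ltnW.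
exists N; split=> //; last by move=> w /negP.
rewrite -[N]setIT -integral_indic// -[RHS](integral0 P setT).
have := integral_next (leqnn n) aG (fun k x y => ler0n _ _).
congr (_ = _); apply: eq_integral => w _.
  by rewrite /G indicE /N mem_setE.
rewrite /step_mean big_seq big1 ?mulr0// => y yE.
by rewrite /G yE.
Qed.

Lemma ae_trajectory : {ae P, forall w, trajectory s x0 (xi ^~ w) (X ^~ w)}.
Proof.
have /ae_foralln := ae_step; apply: filterS => w stepw; split=> //.
by case: hX.
Qed.

(** The inequality is only required along trajectories, and is multiplied by the degree; the degree
    is positive there because [X n.+1] is an endpoint. *)
Lemma integral_next_le m n n' (G : (nat -> nat) -> (nat -> V) -> V -> R)
    (F : (nat -> nat) -> (nat -> V) -> R) :
  (n <= m)%N -> adapted m n G -> (forall k x y, (0 <= G k x y)%R) ->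
  adapted m n' F -> (forall k x, (0 <= F k x)%R) ->
  (forall k x, trajectory s x0 k x ->
    (\sum_(y <- endpoints (tree s k x n.+1) (x n)) G k x y <=
     (#|` endpoints (tree s k x n.+1) (x n)|)%:R * F k x)%R) ->
  \int[P]_w (G (xi ^~ w) (X ^~ w) (X n.+1 w))%:E <=
  \int[P]_w (F (xi ^~ w) (X ^~ w))%:E.
Proof.
move=> nm aG G0 aF F0 GF; rewrite (integral_next nm aG G0).
have aS : adapted m n (fun k x => (step_mean G n k x)%:E).
  move=> k k' x x' kk' xx'; rewrite /step_mean (aG k k' x x')// xx'//.
  by rewrite (@eq_tree _ s k k' x x')// => i i_lt; rewrite kk'// (leq_trans _ nm).
have aF' : adapted m n' (fun k x => (F k x)%:E).
  by move=> k k' x x' kk' xx'; rewrite (aF k k' x x').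
apply: ae_ge0_le_integral => //.
- by move=> w _; rewrite lee_fin mulr_ge0// sumr_ge0.
- exact: measurable_adapted aS.
- by move=> w _; rewrite lee_fin.
- exact: measurable_adapted aF'.
apply: filterS ae_trajectory => w tw _; rewrite lee_fin /step_mean.
rewrite ler_pdivrMl; first exact: GF.
rewrite ltr0n cardfs_gt0; apply/fset0Pn; exists (X n.+1 w).
by case: tw.
Qed.

End MarkovProperty.

(** * Conditional Borel-Cantelli lemmas *)

Section ConditionalBorelCantelli.
Context (R : realType) (d : measure_display) (Omega : measurableType d)
  (P : probability Omega R) (E : nat -> set Omega) (p : nat -> Omega -> R).
Hypothesis mE : forall t, measurable (E t).
Hypothesis mp : forall t, measurable_fun setT (p t).
Hypothesis p_ge0 : forall t w, 0 <= p t w.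

Lemma measurable_fun_partial_sum m n :
  measurable_fun setT (fun w => \sum_(m <= i < n) p i w).
Proof. exact: measurable_sum. Qed.

(** If the last partial sum is at most [K], it dominates the truncated sum; otherwise the last term
    is cut off and induction applies. *)
Lemma truncated_sum_le (q : nat -> R) (K : R) n : 0 <= K ->
  (forall t, 0 <= q t) ->
  \sum_(0 <= t < n) q t * ((\sum_(0 <= i < t.+1) q i <= K)%R)%:R <= K.
Proof.
move=> K0 q0; elim: n => [|n IH]; first by rewrite big_geq.
rewrite big_nat_recr//=; 
have [le_K|_] := leP (\sum_(0 <= i < n.+1) q i) K;
  last by rewrite /= mulr0 addr0.
apply: le_trans le_K; rewrite /= mulr1 [leRHS]big_nat_recr//= lerD2r.
by apply: ler_sum => i _; rewrite ler_piMr// lern1 leq_b1.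
Qed.

Definition sum_le (K : nat) t : set Omega :=
  [set w | \sum_(0 <= i < t.+1) p i w <= K%:R].

Lemma measurable_sum_le K t : measurable (sum_le K t).
Proof.
have := measurable_fun_le measurableT (measurable_fun_partial_sum 0 t.+1)
  (measurable_cst (K%:R : R)).
by rewrite setTI.
Qed.

Local Open Scope ereal_scope.

(** For fixed [K] the truncated events have total probability at most [K], so the first
    Borel-Cantelli lemma applies; then [K] ranges over the naturals. *)
Lemma ae_finitely_often :
  (forall K t, P (E t `&` sum_le K t) <=
    \int[P]_w (p t w * \1_(sum_le K t) w)%:E) ->
  {ae P, forall w, (exists K : nat, forall t, sum_le K t w) ->
    exists N, forall t, (N <= t)%N -> ~ E t w}.
Proof.
move=> EP.
have lim0 K : P (lim_sup_set (fun t => E t `&` sum_le K t)) = 0.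
  apply: lim_sup_set_cvg0 => [t|].
    by apply: measurableI => //; exact: measurable_sum_le.
  apply: (@le_lt_trans _ _ K%:R%:E); last by rewrite ltry.
  apply: lime_le; first exact: is_cvg_nneseries.
  apply: nearW => n.
  apply: (@le_trans _ _ (\sum_(0 <= t < n)
    \int[P]_w (p t w * \1_(sum_le K t) w)%:E)).
    by apply: lee_sum => t _; exact: EP.
  rewrite -ge0_integral_sum//; first last.
  - by move=> t w _; rewrite lee_fin mulr_ge0.
  - move=> t; apply/measurable_EFinP/measurable_funM => //.
    by apply: measurable_indic; exact: measurable_sum_le.
  apply: (@le_trans _ _ (\int[P]_w K%:R%:E)).
    apply: ge0_le_integral => //.
    - by move=> w _; rewrite sume_ge0// => t _; rewrite lee_fin mulr_ge0.
    - apply: emeasurable_sum => t; apply/measurable_EFinP/measurable_funM => //.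
      by apply: measurable_indic; exact: measurable_sum_le.
    - move=> w _; rewrite sumEFin lee_fin.
      apply: le_trans (@truncated_sum_le (p ^~ w) K%:R n _ _) => //.
      by apply: ler_sum => t _; rewrite indicE /sum_le mem_setE.
  by rewrite integral_cst// -[leRHS]mule1 lee_wpmul2l ?lee_fin// probability_le1.
have mlim K : measurable (lim_sup_set (fun t => E t `&` sum_le K t)).
  apply: bigcapT_measurable => n; apply: bigcup_measurable => t _.
  by apply: measurableI => //; exact: measurable_sum_le.
have : {ae P, forall w, forall K,
    ~ lim_sup_set (fun t => E t `&` sum_le K t) w}.
  apply: ae_foralln => K; exists (lim_sup_set (fun t => E t `&` sum_le K t)).
  by split; [exact: mlim|exact: lim0|move=> w /contrapT].
apply: filterS => w nlim [K wK].
have /existsNP[N /not_implyP[_ noE]] := nlim K.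
by exists N => t Nt Et; apply: noE; exists t.
Qed.

(* Supermartingale as E_t has conditional probability p_t: (1 - p)(1 + p) <= 1. *)
Definition survival N n w : R :=
  (\prod_(N <= t < n) ((1 - \1_(E t) w) * (1 + p t w)))%R.

(** If no [E t] occurs from [N] on, [survival] is the product of the [1 + p t], hence at least 1
    plus their sum. By Markov's inequality, a sum of at least [K] then has probability at most
    [1 / (K + 1)]. *)
Lemma ae_infinitely_often :
  (forall N n, \int[P]_w (survival N n w)%:E <= 1) ->
  {ae P, forall w, (forall K : nat, exists n, (K%:R <= \sum_(0 <= i < n) p i w)%R) ->
    forall N, exists2 t, (N <= t)%N & E t w}.
Proof.
move=> survival_le1.
pose B N K n := [set w | forall t, (N <= t)%N -> ~ E t w] `&`
  [set w | (K%:R <= \sum_(N <= i < n) p i w)%R].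
have mB N K n : measurable (B N K n).
  apply: measurableI.
    rewrite [X in measurable X](_ : _ =
        \bigcap_(t in [set t | (N <= t)%N]) ~` E t)//.
    apply: bigcap_measurable => [|t _]; first by exists N => /=.
    exact: measurableC.
  have := measurable_fun_le measurableT (measurable_cst (K%:R : R))
    (measurable_fun_partial_sum N n).
  by rewrite setTI.
have PB N K n : K.+1%:R%:E * P (B N K n) <= 1.
  apply: le_trans (survival_le1 N n).
  have mZ : measurable_fun setT (fun w => (survival N n w)%:E).
    apply/measurable_EFinP; apply: measurable_prod => t _.
    apply: measurable_funM; first by apply: measurable_funB => //; exact: measurable_indic.
    exact: measurable_funD.
  have Z0 w : (0 <= survival N n w)%R.
    apply: prodr_ge0 => t _; apply: mulr_ge0; last by rewrite addr_ge0.
    by rewrite subr_ge0 indicE lern1 leq_b1.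
  rewrite -integral_cst//.
  apply: (@le_trans _ _ (\int[P]_(w in B N K n) (survival N n w)%:E)); last first.
    by apply: ge0_subset_integral => // w _; rewrite lee_fin.
  apply: ge0_le_integral => //.
  - by move=> w _; rewrite lee_fin.
  - exact: measurable_funTS.
  move=> w [noE le_K]; rewrite lee_fin.
  rewrite -natr1 (le_trans (_ : _ <= 1 + \sum_(N <= i < n) p i w)%R)//.
    by rewrite addrC lerD2l.
  rewrite /survival [leRHS](@eq_big_nat _ _ _ _ _ _ (fun t => 1 + p t w)%R); last first.
    move=> t /andP[Nt _]; rewrite indicE memNset ?subr0 ?mul1r//.
    exact: noE.
  elim: n {le_K mZ Z0} => [|n IH]; first by rewrite !big_geq ?addr0.
  have [Nn|nN] := leqP N n; last by rewrite !big_geq ?addr0.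
  rewrite !big_nat_recr//= mulrDr mulr1 addrA lerD// ler_peMl//.
  rewrite (le_trans _ IH)// lerDl sumr_ge0//.
have PU N K : P (\bigcup_n B N K n) <= K.+1%:R^-1%:E.
  have homoB : {homo B N K : m n / (m <= n)%N >-> (m <= n)%O}.
    move=> m n mn; apply/subsetPset => w [noE le_K]; split=> //.
    rewrite /= (le_trans le_K)//.
    have [Nm|mN] := leqP N m; last by rewrite [leLHS]big_geq ?sumr_ge0// ltnW.
    by rewrite [leRHS](big_cat_nat Nm mn)/= lerDl sumr_ge0.
  have cvgB := nondecreasing_cvg_mu (mu := P) (mB N K)
    (bigcupT_measurable _ (mB N K)) homoB.
  rewrite -(cvg_lim _ cvgB)//; apply: lime_le; first exact: cvgP cvgB.
  apply: nearW => n /=.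
  rewrite -(@lee_pmul2l _ K.+1%:R%:E) ?lte_fin//.
  by rewrite -EFinM mulfV ?pnatr_eq0.
have : {ae P, forall w, forall N, ~ (\bigcap_K \bigcup_n B N K n) w}.
  apply: ae_foralln => N; exists (\bigcap_K \bigcup_n B N K n).
  split; last by move=> w /contrapT.
    by apply: bigcapT_measurable => K; apply: bigcupT_measurable.
  apply/eqP; rewrite eq_le measure_ge0 andbT; apply/lee_addgt0Pr => e e0.
  rewrite add0e; have [K Ke] : exists K : nat, (K.+1%:R^-1 <= e)%R.
    exists (Num.truncn e^-1); rewrite -[leRHS]invrK lef_pV2 ?posrE ?invr_gt0//.
    by rewrite ltW// truncnS_gt.
  apply: (@le_trans _ _ (P (\bigcup_n B N K n))).
    apply: le_measure; rewrite ?inE.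
    - by apply: bigcapT_measurable => K'; apply: bigcupT_measurable.
    - exact: bigcupT_measurable.
    - by move=> w; apply.
  by apply: le_trans (PU N K) _; rewrite lee_fin.
apply: filterS => w notB unbounded N; apply: contrapT => noE.
apply: (notB N) => K _.
pose S := (\sum_(0 <= i < N) p i w)%R.
(* The excess over [K] pays for the first [N] terms, whose sum is [S]. *)
have [n le_n] := unbounded (K + Num.truncn S).+1; exists n => //.
split=> [t Nt Et|/=]; first by apply: noE; exists t.
have SK : (S < (Num.truncn S).+1%:R)%R by rewrite truncnS_gt.
have [Nn|nN] := leqP N n.
  have SE : (\sum_(0 <= i < n) p i w = S + \sum_(N <= i < n) p i w)%R.
    by rewrite (big_cat_nat (leq0n N) Nn).
  by move: le_n; rewrite SE -addnS natrD => le_n; lra.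
have : (\sum_(0 <= i < n) p i w <= S)%R.
  by rewrite /S (big_cat_nat (leq0n n) (ltnW nN))//= lerDl sumr_ge0.
move: le_n; rewrite -addnS natrD.
have : (0 <= K%:R :> R)%R by [].
by move=> K0 h1 h2; exfalso; lra.
Qed.

End ConditionalBorelCantelli.

(** * Crossings of a fixed edge *)

Lemma ae_forall_countable (R : realType) (d : measure_display)
    (Omega : measurableType d) (P : probability Omega R) (C : countType)
    (Q : C -> Omega -> Prop) :
  (forall c, {ae P, forall w, Q c w}) -> {ae P, forall w, forall c, Q c w}.
Proof.
move=> aeQ.
have : {ae P, forall w, forall n, if @pickle_inv C n is Some c then Q c w else True}.
  apply: ae_foralln => n; case: pickle_inv => [c|]; first exact: aeQ.
  exact: filterE.
by apply: filterS => w Qw c; have := Qw (choice.pickle c); rewrite pickleK_inv.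
Qed.

Section Crossings.
Context (R : realType) (s : nat) (T0 : rooted_tree) (x0 : vert T0)
  (d : measure_display) (Omega : measurableType d) (P : probability Omega R)
  (xi : nat -> {RV P >-> nat}) (X : nat -> Omega -> vertex T0).
Hypothesis hX : is_TBRW s x0 xi X.
Local Notation V := (vertex T0).
Implicit Types (k : nat -> nat) (x : nat -> V).

Definition cross_prob (a b : V) t k x : R :=
  if x t == a then step_prob R (tree s k x t.+1) (x t) b else 0.

Lemma cross_prob_ge0 a b t k x : 0 <= cross_prob a b t k x.
Proof. by rewrite /cross_prob /step_prob; case: ifP => // _; case: ifP. Qed.

Lemma adapted_cross_prob a b t : adapted t t (cross_prob a b t).
Proof.
move=> k k' x x' kk' xx'; rewrite /cross_prob xx'//.
by rewrite (@eq_tree _ s k k' x x').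
Qed.

Lemma sub_adapted (U : Type) m n m' n' (F : (nat -> nat) -> (nat -> V) -> U) :
  (m <= m')%N -> (n <= n')%N -> adapted m n F -> adapted m' n' F.
Proof.
move=> mm' nn' aF k k' x x' kk' xx'; apply: aF => i im.
  by apply: kk'; exact: leq_trans mm'.
by apply: xx'; exact: leq_trans nn'.
Qed.

Definition cross_set (a b : V) t : set Omega :=
  [set w | X t w = a /\ X t.+1 w = b].

Definition cross_step (a b : V) t x (y : V) : R := ((x t == a) && (y == b))%:R.

Lemma sum_cross_step a b t k x :
  \sum_(y <- endpoints (tree s k x t.+1) (x t)) cross_step a b t x y =
  (#|` endpoints (tree s k x t.+1) (x t)|)%:R * cross_prob a b t k x.
Proof.
rewrite /cross_step /cross_prob /step_prob; set E := endpoints _ _.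
case: eqP => _ /=; last by rewrite big1 ?mulr0.
rewrite -natr_sum; case: ifPn => [bE|bE].
  rewrite mulfV; last first.
    by rewrite pnatr_eq0 cardfs_eq0; apply/fset0Pn; exists b.
  rewrite (big_fsetD1 b)//= eqxx big_seq big1 ?addn0//.
  by move=> y /fsetD1P[/negbTE ->].
rewrite mulr0 big_seq big1// => y yE.
by have -> : (y == b) = false by apply: contraNF bE => /eqP <-.
Qed.

Lemma measurable_cross_set a b t : measurable (cross_set a b t).
Proof.
apply: measurableI; first exact: (measurable_X hX t [set a]).
exact: (measurable_X hX t.+1 [set b]).
Qed.

Lemma measurable_adapted_fun m n (F : (nat -> nat) -> (nat -> V) -> R) :
  adapted m n F -> measurable_fun setT (fun w => F (xi ^~ w) (X ^~ w)).
Proof.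
move=> aF; apply/measurable_EFinP.
apply: (measurable_adapted hX (m := m) (n := n) (F := fun k x => (F k x)%:E)).
by move=> k k' x x' kk' xx'; rewrite (aF k k' x x').
Qed.

Lemma cross_stepE a b t w : cross_step a b t (X ^~ w) (X t.+1 w) =
  \1_(cross_set a b t) w.
Proof.
rewrite indicE /cross_step; congr ((nat_of_bool _)%:R).
apply/andP/idP => [[/eqP Xa /eqP Xb]|]; first by rewrite inE.
by rewrite inE => -[-> ->].
Qed.

Local Notation p a b := (fun t w => cross_prob a b t (xi ^~ w) (X ^~ w)).

(** Induction on [n]: given the past, the last factor has mean [(1 - q) * (1 + q) <= 1]. *)
Lemma survival_le1 a b N n :
  (\int[P]_w (survival (cross_set a b) (p a b) N n w)%:E <= 1)%E.
Proof.
pose Z n k x : R := \prod_(N <= t < n)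
  ((1 - cross_step a b t x (x t.+1)) * (1 + cross_prob a b t k x)).
have ZE m w : survival (cross_set a b) (p a b) N m w = Z m (xi ^~ w) (X ^~ w).
  by apply: eq_bigr => t _; rewrite cross_stepE.
under eq_integral do rewrite ZE.
have Z0 m k x : 0 <= Z m k x.
  apply: prodr_ge0 => t _; apply: mulr_ge0.
    by rewrite subr_ge0 lern1 leq_b1.
  by rewrite addr_ge0// cross_prob_ge0.
have aZ m : adapted m m (Z m).
  move=> k k' x x' kk' xx'; apply: eq_big_nat => t /andP[_ tm].
  rewrite /cross_step !xx'//; last exact: ltnW.
  by rewrite (@adapted_cross_prob a b t k k' x x')// => i it;
    rewrite ?kk' ?xx'// (leq_trans it)// ltnW.
elim: n => [|n IH].
  under eq_integral do rewrite /Z big_geq//.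
  by rewrite integral_cst// mul1e probability_le1.
have [Nn|nN] := leqP N n; last first.
  under eq_integral do rewrite /Z big_geq//.
  by rewrite integral_cst// mul1e probability_le1.
apply: le_trans IH.
pose G k x y := Z n k x * ((1 - cross_step a b n x y) * (1 + cross_prob a b n k x)).
under eq_integral do rewrite /Z big_nat_recr//=.
apply: (integral_next_le (m := n) (n := n) (n' := n) hX (G := G)) => //.
- move=> k k' x x' kk' xx'; apply/funext => y; rewrite /G (aZ n k k' x x')//.
  by rewrite /cross_step xx'// (@adapted_cross_prob a b n k k' x x').
- move=> k x y; rewrite mulr_ge0// mulr_ge0//.
    by rewrite subr_ge0 lern1 leq_b1.
  by rewrite addr_ge0// cross_prob_ge0.
move=> k x kx; rewrite /G -mulr_sumr -mulr_suml sumrB sum_cross_step.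
set q := cross_prob a b n k x; set D := #|` _|.
have -> : \sum_(y <- endpoints (tree s k x n.+1) (x n)) 1 = D%:R :> R.
  by rewrite big_const_seq count_predT iter_addr_0.
have -> : (D%:R - D%:R * q) * (1 + q) = D%:R - D%:R * q ^+ 2 by ring.
by rewrite mulrC ler_wpM2r// lerBlDr lerDl mulr_ge0// sqr_ge0.
Qed.

Lemma cross_le_cross_prob a b K t :
  (P (cross_set a b t `&` sum_le (p a b) K t) <=
   \int[P]_w (p a b t w * \1_(sum_le (p a b) K t) w)%:E)%E.
Proof.
pose D k x : R := ((\sum_(0 <= i < t.+1) cross_prob a b i k x <= K%:R)%R)%:R.
have aD : adapted t t D.
  move=> k k' x x' kk' xx'; rewrite /D; congr ((nat_of_bool (_ <= _))%:R).
  apply: eq_big_nat => i /andP[_ it]; apply: (@adapted_cross_prob a b i) => j ji.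
    by apply: kk'; exact: leq_trans ji _.
  by apply: xx'; exact: leq_trans ji _.
have DE w : \1_(sum_le (p a b) K t) w = D (xi ^~ w) (X ^~ w).
  by rewrite indicE /D /sum_le mem_setE.
have mS : measurable (cross_set a b t `&` sum_le (p a b) K t).
  apply: measurableI; first exact: measurable_cross_set.
  apply: measurable_sum_le => i.
  exact: measurable_adapted_fun (@adapted_cross_prob a b i).
rewrite -[X in P X]setIT -integral_indic//.
under eq_integral do rewrite indicI /= -cross_stepE DE.
under [leRHS]eq_integral do rewrite DE.
apply: (integral_next_le (m := t) (n := t) (n' := t) hX
  (G := fun k x y => cross_step a b t x y * D k x)
  (F := fun k x => cross_prob a b t k x * D k x)) => //.
- move=> k k' x x' kk' xx'; apply/funext => y.
  by rewrite (aD k k' x x')// /cross_step xx'.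
- by move=> k x y; rewrite mulr_ge0.
- move=> k k' x x' kk' xx'.
  by rewrite (aD k k' x x')// (@adapted_cross_prob a b t k k' x x').
- by move=> k x; rewrite mulr_ge0// cross_prob_ge0.
- by move=> k x kx; rewrite -mulr_suml sum_cross_step mulrA.
Qed.

(** Vertices form a countable type, so one null set serves all pairs at once. *)
Lemma ae_crosses_io : {ae P, forall w, forall ab : V * V,
  (forall K : nat, exists n,
     K%:R <= \sum_(0 <= t < n) cross_prob ab.1 ab.2 t (xi ^~ w) (X ^~ w)) <->
  crosses_io (X ^~ w) ab.1 ab.2}.
Proof.
apply: ae_forall_countable => -[a b] /=.
have mp t : measurable_fun setT (p a b t).
  exact: measurable_adapted_fun (@adapted_cross_prob a b t).
have p0 t w : 0 <= p a b t w by exact: cross_prob_ge0.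
have io := ae_infinitely_often (measurable_cross_set a b) mp p0 (survival_le1 a b).
have fo := ae_finitely_often (P := P) (measurable_cross_set a b) mp p0
  (cross_le_cross_prob a b).
apply: filterS2 io fo => w iow fow; split; first exact: iow.
move=> ab K; apply: contrapT => /forallNP noK.
have [|N noN] := fow.
  by exists K => t; rewrite /sum_le /= ltW// ltNge; apply/negP/noK.
by have [t Nt abt] := ab N; exact: noN Nt abt.
Qed.

End Crossings.

(** * Recurrence *)

Lemma limn_esup_lt (R : realType) (u : nat -> \bar R) (y : \bar R) :
  (limn_esup u < y)%E -> exists N, forall n, (N <= n)%N -> (u n < y)%E.
Proof.
rewrite /limn_esup limf_esupE => /ereal_inf_lt[_ [A [N _ NA] <-] supA].
exists N => n Nn; apply: le_lt_trans supA; apply: ereal_sup_ubound.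
by exists n => //; exact: NA.
Qed.

Lemma limn_einf_gt (R : realType) (u : nat -> \bar R) (y : \bar R) :
  (y < limn_einf u)%E -> exists N, forall n, (N <= n)%N -> (y < u n)%E.
Proof.
rewrite -lteN2 -limn_esupN => /limn_esup_lt[N uy].
by exists N => n /uy; rewrite lteN2.
Qed.

Section Series.
Context (R : realType).
Implicit Types (f g u : nat -> R).

Lemma nneseries_bounded u m (M : R) : (forall n, (m <= n)%N -> 0 <= u n) ->
  (forall n, \sum_(m <= i < n) u i <= M) ->
  (\sum_(m <= i <oo) (u i)%:E <= M%:E)%E.
Proof.
move=> u0 uM; apply: lime_le.
  by apply: is_cvg_nneseries => n mn _; rewrite lee_fin u0.
by apply: nearW => n; rewrite sumEFin lee_fin.
Qed.

Lemma partial_sum_bounded u m : (forall n, (m <= n)%N -> 0 <= u n) ->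
  (\sum_(m <= i <oo) (u i)%:E < +oo)%E ->
  exists M : R, forall n, \sum_(m <= i < n) u i <= M.
Proof.
move=> u0 fin.
have S0 : (0 <= \sum_(m <= i <oo) (u i)%:E)%E.
  by apply: nneseries_ge0 => n mn _; rewrite lee_fin u0.
exists (fine (\sum_(m <= i <oo) (u i)%:E)) => n.
rewrite -lee_fin fineK ?ge0_fin_numE// -sumEFin.
by apply: nneseries_lim_ge => i mi _; rewrite lee_fin u0.
Qed.

Lemma bounded_terms_small u m (K e : R) : (forall n, (m <= n)%N -> 0 <= u n) ->
  (forall n, \sum_(m <= i < n) u i <= K) -> 0 < e ->
  exists N, forall n, (N <= n)%N -> u n < e.
Proof.
move=> u0 uK e0; pose v i := u (m + i)%N.
have v0 i : 0 <= v i by apply: u0; rewrite leq_addr.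
have cvgv : cvgn (series v).
  apply: nondecreasing_is_cvgn.
    move=> p q pq; rewrite /series /= [leRHS](big_cat_nat (leq0n p) pq)/=.
    by rewrite lerDl sumr_ge0.
  exists K => _ [n _ <-]; apply: le_trans (uK (m + n)%N).
  rewrite /series /= -{1}[m]add0n big_addn addKn.
  by apply: ler_sum => i _; rewrite /v addnC.
have [N _ Nv] := cvgr_lt _ (cvg_series_cvg_0 cvgv) _ e0.
exists (m + N)%N => n mNn; have := Nv (n - m)%N; rewrite /v subnKC; last by lia.
by apply; rewrite /=; lia.
Qed.

(** If the new series were bounded, its terms would tend to 0, so [B * g] would eventually exceed
    [A] and the series of [1 / g] would converge by comparison. *)
Lemma divergent_shift g (A B : R) m : (0 < m)%N ->
  (forall n, (0 < n)%N -> 0 < g n) ->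
  (\sum_(1 <= n <oo) ((g n)^-1)%:E = +oo)%E -> 0 < A -> 0 < B ->
  forall K : R, exists n, K <= \sum_(m <= i < n) (A + B * g i)^-1.
Proof.
move=> m0 g0 gdiv A0 B0 K; apply: contrapT => /forallNP small.
pose u i := (A + B * g i)^-1.
have u_gt0 n : (0 < n)%N -> 0 < u n.
  by move=> n0; rewrite invr_gt0 addr_gt0// mulr_gt0// g0.
have u0 n : (m <= n)%N -> 0 <= u n.
  by move=> mn; rewrite ltW// u_gt0// (leq_trans m0 mn).
have uK n : \sum_(m <= i < n) u i <= K by rewrite ltW// ltNge; apply/negP/small.
(* A term below [1 / (2 * A)] means [A < B * g n], whence [1 / g n <= 2 * B * u n]. *)
have e0 : 0 < (2 * A)^-1 by rewrite invr_gt0 mulr_gt0.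
have [N Nu] := bounded_terms_small u0 uK e0.
pose N' := maxn m N.
have gu n : (N' <= n)%N -> (g n)^-1 <= 2 * B * u n.
  rewrite geq_max => /andP[mn Nn].
  have n0 : (0 < n)%N by exact: leq_trans mn.
  have gn0 := g0 _ n0; have Bg : 0 < B * g n by rewrite mulr_gt0.
  have den : 0 < A + B * g n by rewrite addr_gt0.
  have := Nu _ Nn; rewrite /u ltf_pV2 ?posrE ?mulr_gt0// => AB.
  rewrite -[leLHS]mul1r ler_pdivrMr// mulrAC ler_pdivlMr//; lra.
have : (\sum_(1 <= n <oo) ((g n)^-1)%:E <=
    (\sum_(1 <= n < N') (g n)^-1 + 2 * B * K)%:E)%E.
  apply: nneseries_bounded => [n n0|n]; first by rewrite invr_ge0 ltW// g0.
  have [N'n|nN'] := leqP N' n; last first.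
    have [n1|n1] := leqP 1 n; last first.
      rewrite big_geq//; last by lia.
      rewrite addr_ge0//; last first.
        by rewrite !mulr_ge0 ?(ltW B0)// (le_trans _ (uK m))// big_geq.
      rewrite big_nat sumr_ge0// => i /andP[i1 _].
      by rewrite invr_ge0 ltW// g0.
    rewrite [leRHS]addrC (big_cat_nat n1 (ltnW nN'))/= addrCA lerDl addr_ge0//.
      by rewrite !mulr_ge0 ?(ltW B0)// (le_trans _ (uK m))// big_geq.
    by rewrite big_nat sumr_ge0// => i /andP[ni _]; rewrite invr_ge0 ltW// g0//; lia.
  have N'1 : (1 <= N')%N by rewrite /N'; lia.
  rewrite (big_cat_nat N'1 N'n)/= lerD2l.
  apply: (@le_trans _ _ (2 * B * \sum_(N' <= i < n) u i)).
    rewrite mulr_sumr; apply: ler_sum_nat => i /andP[N'i _]; exact: gu.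
  rewrite ler_wpM2l ?mulr_ge0 ?(ltW B0)// (le_trans _ (uK n))//.
  have mN' : (m <= N')%N by rewrite leq_maxl.
  rewrite [leRHS](big_cat_nat mN' N'n)/= lerDr big_nat sumr_ge0// => i /andP[mi _].
  exact: u0.
by rewrite gdiv leye_eq.
Qed.

End Series.

Lemma big_multiples (U : Type) (idx : U) (op : Monoid.law idx) (F : nat -> U)
    (s j : nat) : (0 < s)%N ->
  \big[op/idx]_(0 <= i < (s * j).+1 | (s %| i)%N) F i =
  \big[op/idx]_(0 <= i < j.+1) F (s * i)%N.
Proof.
move=> s0; elim: j => [|j IH].
  by rewrite muln0 big_mkcond !big_nat1 dvdn0 muln0.
have le_j : ((s * j).+1 <= (s * j.+1).+1)%N by rewrite ltnS leq_pmul2l.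
rewrite (big_cat_nat (leq0n _) le_j)/= IH [RHS]big_nat_recr//=.
congr (op _ _); rewrite big_mkcond big_nat_recr/=; last by rewrite ltn_pmul2l.
rewrite dvdn_mulr// big_nat big1 ?Monoid.mul1m// => i /andP[ji ij].
case: ifP => // /dvdnP[q iE]; move: ji ij.
by rewrite iE [(q * s)%N]mulnC !ltn_pmul2l// => jq; rewrite ltnS leqNgt jq.
Qed.

Section Recurrence.
Context (R : realType) (s : nat) (T0 : rooted_tree) (x0 : vert T0).
Local Notation V := (vertex T0).
Context (k : nat -> nat) (x : nat -> V).
Hypothesis kx : trajectory s x0 k x.
Hypothesis s_gt0 : (0 < s)%N.
Hypothesis s_even : ~~ odd s.
Local Notation T := (tree s k x).
Local Notation p a b := (fun t => cross_prob R s a b t k x).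
Hypothesis crosses_io_iff : forall ab : V * V,
  (forall K : nat, exists n, K%:R <= \sum_(0 <= t < n) p ab.1 ab.2 t) <->
  crosses_io x ab.1 ab.2.

Lemma cross_prob_le1 a b t : p a b t <= 1.
Proof.
rewrite /cross_prob /step_prob; case: ifP => // _; case: ifP => // bE.
rewrite invf_le1 ?ltr0n ?ler1n cardfs_gt0; by apply/fset0Pn; exists b.
Qed.

(** From time [n] on, a visit to [a] leads to [b] with probability one over the degree, at least
    that of leading to [c]. The earlier terms add at most [n]. *)
Lemma crosses_io_swap n a b c : (a, b) \in edges (T n) ->
  crosses_io x a c -> crosses_io x a b.
Proof.
move=> abT /(crosses_io_iff (a, c)) /= ac.
apply/(crosses_io_iff (a, b)) => /= K.
have [m le_m] := ac (K + n)%N; exists m.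
rewrite -(lerD2r n%:R) -natrD (le_trans le_m)//.
have p0 e t : 0 <= p a e t by exact: cross_prob_ge0.
have p_le t : (n <= t)%N -> p a c t <= p a b t.
  move=> nt; rewrite /cross_prob; case: eqP => // xa; rewrite /step_prob.
  have -> : b \in endpoints (T t.+1) (x t).
    by rewrite xa mem_endpoints; apply: tree_edges_le abT; exact: leqW.
  by case: ifP => // _; rewrite invr_ge0.
have le_n j : \sum_(0 <= t < j) p a c t <= j%:R.
  rewrite -[j in leRHS]subn0 -sumr_const_nat; apply: ler_sum => t _.
  exact: cross_prob_le1.
have [nm|mn] := leqP n m; last first.
  by rewrite (le_trans (le_n m))// ler_wpDl ?sumr_ge0// ler_nat ltnW.
rewrite (big_cat_nat (leq0n n) nm)/= addrC lerD//.
rewrite [leRHS](big_cat_nat (leq0n n) nm)/= ler_wpDl ?sumr_ge0//.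
by apply: ler_sum_nat => t /andP[/p_le].
Qed.

(** The time is just after the growth at [s * j]. The leaves of time 0, which [S_] omits, are
    counted by [2 * k 0]. *)
Lemma endpoints_card_le j (a : V) : (#|` endpoints (T (s * j).+1) a| <=
  #|` edges (initial_graph T0)| + 2 * k 0 +
  2 * \sum_(1 <= i < j.+1) k (s * i))%N.
Proof.
apply: leq_trans (card_endpoints _ _) _.
apply: leq_trans (@card_tree_edges _ _ _ _ _) _.
by rewrite big_multiples// big_ltn// muln0 mulnDr addnA.
Qed.

(** At each large multiple [s * j] the trapped walker stands at [a] and steps to [b] with
    probability at least [1 / (A + 2 * C * g j)], and these bounds have a divergent sum. *)
Lemma trapped_crosses_io (C : R) (g : nat -> R) (n0 t : nat) : 0 < C ->
  (forall n, (0 < n)%N -> 0 < g n) ->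
  (\sum_(1 <= n <oo) ((g n)^-1)%:E = +oo)%E ->
  (forall n, (n0 <= n)%N -> (\sum_(1 <= i < n.+1) k (s * i))%N%:R <= C * g n) ->
  ~~ odd t -> (forall m, x (t + 2 * m)%N = x t) ->
  crosses_io x (x t) (x t.+1).
Proof.
move=> C0 g0 gdiv kg oddt trap.
set a := x t; set b := x t.+1.
apply/(crosses_io_iff (a, b)) => /= K.
pose A : R := (#|` edges (initial_graph T0)| + 2 * k 0%N).+1%:R.
pose m := maxn 1 (maxn n0 t).
have [n le_n] := divergent_shift (m := m) (leq_maxl _ _) g0 gdiv
  (ltr0Sn _ _ : 0 < A) (mulr_gt0 (ltr0Sn _ 1) C0) K%:R.
exists (s * n).+1; apply: le_trans le_n _.
have p0 i : 0 <= p a b i by exact: cross_prob_ge0.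
have p_ge j : (m <= j)%N -> (A + 2 * C * g j)^-1 <= p a b (s * j).
  move=> mj; have tj : (t <= s * j)%N.
    by rewrite (@leq_trans j)//; [rewrite (leq_trans _ mj)// /m; lia|exact: leq_pmull].
  have j0 : (0 < j)%N by rewrite (leq_trans _ mj)// leq_maxl.
  have xa : x (s * j)%N = a.
    (* Both [s * j] and [t] are even, so they differ by a whole number of periods. *)
    have -> : (s * j = t + 2 * ((s * j - t)./2))%N.
      have := odd_double_half (s * j - t).
      rewrite oddB// oddM (negbTE s_even) (negbTE oddt) /=.
      by rewrite -mul2n; lia.
    exact: trap.
  rewrite /cross_prob xa eqxx /step_prob.
  have bE : b \in endpoints (T (s * j).+1) a.
    rewrite mem_endpoints; apply: tree_edges_le (traj_edge kx (ltnSn t)).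
    by rewrite ltnS.
  rewrite bE lef_pV2 ?posrE; last 2 first.
  - by rewrite addr_gt0 ?ltr0Sn// !mulr_gt0// g0.
  - by rewrite ltr0n cardfs_gt0; apply/fset0Pn; exists b.
  have := endpoints_card_le j a; rewrite -(ler_nat R) natrD natrM => /le_trans; apply.
  have : (\sum_(1 <= i < j.+1) k (s * i))%N%:R <= C * g j.
    by apply: kg; rewrite (leq_trans _ mj)// /m; lia.
  by rewrite /A -natr1; lra.
have [mn|nm] := leqP m n.+1; last first.
  by rewrite [leLHS]big_geq ?sumr_ge0// ltnW// ltnW.
apply: (@le_trans _ _ (\sum_(0 <= i < n.+1) p a b (s * i)%N)).
  rewrite [leRHS](big_cat_nat (leq0n m) mn)/= ler_wpDl ?sumr_ge0//.
  apply: (@le_trans _ _ (\sum_(m <= i < n.+1) (A + 2 * C * g i)^-1)).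
    rewrite -[leLHS]addr0.
    have [mn'|nm'] := leqP m n; last first.
      by rewrite [in leLHS]big_geq ?[in leRHS]big_geq ?addr0//; lia.
    rewrite big_nat_recr//= lerD2l ltW// invr_gt0 addr_gt0 ?ltr0Sn//.
    by rewrite !mulr_gt0// g0// (leq_trans _ mn')// leq_maxl.
  by apply: ler_sum_nat => i /andP[/p_ge].
rewrite -(big_multiples _ (p a b) n s_gt0) big_mkcond.
by apply: ler_sum => i _; case: ifP.
Qed.

Lemma visits_io_everywhere (v : vert T0) a c :
  (self_loop T0 -> v = tree_root T0) -> crosses_io x a c ->
  forall n z, z \in vertices (T n) -> forall N, exists2 m, (N <= m)%N & x m = z.
Proof.
move=> v_root ac n z zT N.
have [q zq] := crosses_io_everywhere v_root kx crosses_io_swap ac zT.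
by have [m Nm [xm _]] := zq N; exists m.
Qed.

End Recurrence.

(** * Crossings of an edge in a dyadic block of times *)

Section DiscountedCrossings.
Context (R : realType) (s : nat) (T0 : rooted_tree) (x0 : vert T0)
  (d : measure_display) (Omega : measurableType d) (P : probability Omega R)
  (xi : nat -> {RV P >-> nat}) (X : nat -> Omega -> vertex T0).
Hypothesis hX : is_TBRW s x0 xi X.
Local Notation V := (vertex T0).
Implicit Types (k : nat -> nat) (x : nat -> V).
Context (v w : vert T0) (beta : R).
Hypothesis v_root : self_loop T0 -> v = tree_root T0.
Hypothesis beta_gt0 : 0 < beta.
Hypothesis beta_le1 : beta <= 1.
Local Notation U := (potential s v beta).
Local Notation rate := (rate s beta).
Local Notation delta := (delta s beta).
Local Notation "'E[ F ]" := (\int[P]_u (F (xi ^~ u) (X ^~ u))%:E)%E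
  (format "''E[' F ]").

Lemma integral_le_traj m n m' n' (F G : (nat -> nat) -> (nat -> V) -> R) :
  adapted m n F -> adapted m' n' G -> (forall k x, 0 <= F k x) ->
  (forall k x, 0 <= G k x) ->
  (forall k x, trajectory s x0 k x -> F k x <= G k x) -> ('E[F] <= 'E[G])%E.
Proof.
move=> aF aG F0 G0 FG; apply: ae_ge0_le_integral => //.
- by move=> u _; rewrite lee_fin.
- exact/measurable_EFinP/(measurable_adapted_fun hX aF).
- by move=> u _; rewrite lee_fin.
- exact/measurable_EFinP/(measurable_adapted_fun hX aG).
by apply: filterS (ae_trajectory hX) => u tu _; rewrite lee_fin FG.
Qed.

Lemma integralD_adapted m n m' n' (F G : (nat -> nat) -> (nat -> V) -> R) :
  adapted m n F -> adapted m' n' G -> (forall k x, 0 <= F k x) ->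
  (forall k x, 0 <= G k x) ->
  'E[fun k x => F k x + G k x] = ('E[F] + 'E[G])%E.
Proof.
move=> aF aG F0 G0; rewrite -ge0_integralD//.
- by move=> u _; rewrite lee_fin.
- exact/measurable_EFinP/(measurable_adapted_fun hX aF).
- by move=> u _; rewrite lee_fin.
- exact/measurable_EFinP/(measurable_adapted_fun hX aG).
Qed.

Lemma adapted_potential n z : adapted n n (fun k x => U k x n.+1 z).
Proof.
by move=> k k' x x' kk' xx'; rewrite (@eq_potential _ _ _ _ _ k k' x x').
Qed.

Lemma payoff_ge (f : V -> R) y z : f z <= 1 -> f z <= @payoff R V (inl v) (inl w) f y z.
Proof. by rewrite /payoff; case: ifP. Qed.

Lemma sum_payoff_potential k x n : trajectory s x0 k x ->
  \sum_(y <- endpoints (tree s k x n.+1) (x n))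
     @payoff R V (inl v) (inl w) (U k x n.+1) (x n) y <=
  (#|` endpoints (tree s k x n.+1) (x n)|)%:R * (beta^-1 * U k x n.+1 (x n)).
Proof.
move=> kx; rewrite mulrCA -(ler_pM2l beta_gt0) mulVKf ?gt_eqF//.
apply: (supersolution_potential w beta_gt0 beta_le1 v_root kx).
by have := traj_mem v_root kx (leqnSn n).
Qed.

(** The arbitrary weight [F] stands in for conditioning on the environment. One step costs
    [beta^-1], and the tangent bound at [rate k n], a constant given the environment, makes the
    estimate affine, so the induction hypothesis applies with a new weight. *)
Lemma expected_potential_le_rate m n (F : (nat -> nat) -> R) : (n <= m)%N ->
  (forall k k', (forall i, (i <= m)%N -> k i = k' i) -> F k = F k') ->
  (forall k, 0 <= F k) ->
  ('E[fun k x => F k * U k x n (x n)] <= 'E[fun k x => F k * rate k n])%E.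
Proof.
elim: n F => [//|n IH] F nm aF F0.
have r0 k : 0 <= rate k n by rewrite ltW// rate_gt0.
have d0 k : 0 <= delta k n by exact: delta_ge0.
have U0 k x j z : 0 <= U k x j z.
  by case/andP: (potential01 s v beta_gt0 beta_le1 k x j z) => /ltW.
have b0 : 0 <= beta^-1 by rewrite invr_ge0 ltW.
have den k : 0 < 1 + delta k n * rate k n by rewrite ltr_wpDr// mulr_ge0.
(* The coefficient of the potential in the tangent bound. Putting [rate k n] for the potential in
   that bound gives exactly [F k * rate k n.+1]. *)
pose F' k := F k * (beta^-1 / (1 + delta k n * rate k n) ^+ 2).
have F'0 k : 0 <= F' k by rewrite mulr_ge0// divr_ge0// sqr_ge0.
have aF' k k' : (forall i, (i <= m)%N -> k i = k' i) -> F' k = F' k'.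
  move=> kk'; rewrite /F' (aF k k')// (@eq_delta _ s beta k k') ?kk' 1?ltnW//.
  by rewrite (@eq_rate _ s beta k k')// => i i_lt; rewrite kk'//; lia.
pose H k x := F' k * (delta k n * rate k n ^+ 2) + F' k * U k x n (x n).
have aU : adapted m n (fun k x => U k x n (x n)).
  by move=> k k' x x' kk' xx'; rewrite (@eq_potential _ _ _ _ _ k k' x x') ?xx'//;
    move=> i i_lt; rewrite ?kk' ?xx'//; lia.
have aD : adapted m 0 (fun k x => F' k * (delta k n * rate k n ^+ 2)).
  move=> k k' x x' kk' _; rewrite (aF' k k')// (@eq_delta _ s beta k k') ?kk' 1?ltnW//.
  by rewrite (@eq_rate _ s beta k k')// => i i_lt; rewrite kk'//; lia.
have aF1 : adapted m 0 (fun k (_ : nat -> V) => F k).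
  by move=> k k' x x' kk' _; exact: aF.
apply: (@le_trans _ _ 'E[fun k x => F k * (beta^-1 * U k x n.+1 (x n))]).
  apply: (integral_next_le (m := m) (n := n) (n' := n) hX
    (G := fun k x y => F k * U k x n.+1 y)
    (F := fun k x => F k * (beta^-1 * U k x n.+1 (x n)))); first exact: ltnW.
  - move=> k k' x x' kk' xx'; apply/funext => y; rewrite (aF k k')//.
    rewrite (@adapted_potential n y k k' x x')// => i i_n.
    by rewrite kk'// (leq_trans i_n)// ltnW.
  - by move=> k x y; rewrite mulr_ge0.
  - move=> k k' x x' kk' xx'; rewrite (aF k k')// xx'//.
    rewrite (@adapted_potential n (x' n) k k' x x')// => i i_n.
    by rewrite kk'// (leq_trans i_n)// ltnW.
  - by move=> k x; rewrite !mulr_ge0.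
  move=> k x kx; rewrite -mulr_sumr mulrCA ler_wpM2l//.
  apply: (le_trans _ (sum_payoff_potential n kx)); apply: ler_sum => y _.
  by apply: payoff_ge; case/andP: (potential01 s v beta_gt0 beta_le1 k x n.+1 y).
have aH2 : adapted m n (fun k x => F' k * U k x n (x n)).
  by move=> k k' x x' kk' xx'; rewrite (aF' k k')// (aU k k' x x').
have aH : adapted m n H.
  by move=> k k' x x' kk' xx'; congr (_ + _);
    [exact: (@sub_adapted _ _ _ _ _ _ _ (leqnn m) (leq0n n) aD k k' x x')|exact: aH2].
have den2 k : 0 <= (1 + delta k n * rate k n) ^- 2 by rewrite invr_ge0 sqr_ge0.
have H0 k x : 0 <= H k x by rewrite addr_ge0// !mulr_ge0// ?sqr_ge0.
apply: (@le_trans _ _ 'E[H]).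
  apply: (@integral_le_traj m n m n
    (fun k x => F k * (beta^-1 * U k x n.+1 (x n))) H) => //.
  - move=> k k' x x' kk' xx'; rewrite (aF k k')// xx'//.
    rewrite (@adapted_potential n (x' n) k k' x x')// => i i_n.
    by rewrite kk'// (leq_trans i_n)// ltnW.
  - by move=> k x; rewrite !mulr_ge0.
  move=> k x kx; rewrite /H /F' -mulrDr -!mulrA ler_wpM2l// ler_wpM2l//.
  rewrite mulrC; exact: (potential_growth_le beta_gt0 beta_le1 v_root kx n (r0 k)).
have -> : 'E[H] = ('E[fun k x => F' k * (delta k n * rate k n ^+ 2)] +
    'E[fun k x => F' k * U k x n (x n)])%E.
  by apply: (integralD_adapted aD aH2) => k x; rewrite !mulr_ge0// ?sqr_ge0.
apply: (@le_trans _ _ ('E[fun k x => F' k * (delta k n * rate k n ^+ 2)] +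
    'E[fun k x => F' k * rate k n])%E).
  by rewrite leeD2l//; apply: IH => //; exact: ltnW.
have aFr : adapted m 0 (fun k (_ : nat -> V) => F' k * rate k n).
  move=> k k' x x' kk' _; rewrite (aF' k k')// (@eq_rate _ s beta k k')// => i i_lt.
  by rewrite kk'//; lia.
rewrite -(integralD_adapted aD aFr); first last.
- by move=> k x; rewrite mulr_ge0.
- by move=> k x; rewrite !mulr_ge0// ?sqr_ge0.
rewrite le_eqVlt; apply/orP; left; apply/eqP; apply: eq_integral => u _.
congr (_%:E); rewrite /F' /=; have := den (xi ^~ u); move: (rate _ n) (delta _ n) => r dl.
by move=> den0; field; rewrite !gt_eqF.
Qed.

Local Notation c n x y := (cross_step R (inl v : V) (inl w) n x y).

Definition crosses_between n j x : bool :=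
  has (fun t => (x t == inl v) && (x t.+1 == inl w)) (iota n j).

Lemma adapted_crosses_between m n j :
  adapted m (n + j) (fun (_ : nat -> nat) x => (crosses_between n j x)%:R : R).
Proof.
move=> k k' x x' _ xx'; congr ((nat_of_bool _)%:R); apply: eq_in_has => t.
by rewrite mem_iota => /andP[_ tj]; rewrite !xx'// ltnW.
Qed.

Lemma potential_growth_noninc k x n : trajectory s x0 k x ->
  U k x n.+1 (x n) <= U k x n (x n).
Proof.
move=> kx; rewrite (potential_growth beta v_root kx n).
have /andP[u0 _] := potential01 s v beta_gt0 beta_le1 k x n (x n).
have d0 : 0 <= delta k n by exact: delta_ge0.
rewrite ler_pdivrMr; last by rewrite ltr_wpDr// mulr_ge0// ltW.
by rewrite ler_peMr ?lerDl ?mulr_ge0// ltW.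
Qed.

(** Decomposition according to the first step: either it crosses the edge and earns 1, or the walk
    goes on with the weight restricted to no crossing, which is why [F] may depend on the
    trajectory. Growth only lowers the potential at the walker. *)
Lemma crossing_le_potential m j n (F : (nat -> nat) -> (nat -> V) -> R) :
  (n + j <= m)%N -> adapted m n F -> (forall k x, 0 <= F k x) ->
  ('E[fun k x => F k x * (crosses_between n j x)%:R] <=
   'E[fun k x => F k x * (beta^-1 ^+ j * U k x n (x n))])%E.
Proof.
have U0 k x i z : 0 <= U k x i z.
  by case/andP: (potential01 s v beta_gt0 beta_le1 k x i z) => /ltW.
have b0 : 0 <= beta^-1 by rewrite invr_ge0 ltW.
have b1 : 1 <= beta^-1 by rewrite invf_ge1.
have aU i l : (i <= m)%N -> adapted m i (fun k x => l * U k x i (x i)).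
  move=> im k k' x x' kk' xx'; rewrite xx'//.
  by rewrite (@eq_potential _ _ _ _ _ k k' x x')// => a ai;
    rewrite ?kk' ?xx'// ltnW// (leq_trans ai).
have adaptedM i (G H : (nat -> nat) -> (nat -> V) -> R) : adapted m i G ->
    adapted m i H -> adapted m i (fun k x => G k x * H k x).
  by move=> aG aH k k' x x' kk' xx'; rewrite (aG k k' x x')// (aH k k' x x').
elim: j n F => [|j IH] n F njm aF F0.
  rewrite addn0 in njm.
  apply: (@integral_le_traj m n m n (fun k x => F k x * (crosses_between n 0 x)%:R)
    (fun k x => F k x * (beta^-1 ^+ 0 * U k x n (x n)))).
  - apply: adaptedM aF _; have := @adapted_crosses_between m n 0.
    by rewrite addn0.
  - by apply: adaptedM aF _; exact: aU.
  - by move=> k x; rewrite mulr_ge0.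
  - by move=> k x; rewrite !mulr_ge0// exprn_ge0.
  - by move=> k x _; rewrite mulr0 !mulr_ge0// exprn_ge0.
have aF1 : adapted m n.+1 F by exact: sub_adapted aF.
pose F' k x := F k x * (1 - c n x (x n.+1)).
pose F1 k x := F k x * c n x (x n.+1).
have ac : adapted m n.+1 (fun _ x => c n x (x n.+1)).
  by move=> k k' x x' kk' xx'; rewrite /cross_step !xx'.
have aF' : adapted m n.+1 F'.
  apply: adaptedM aF1 _ => k k' x x' kk' xx'; congr (1 - _).
  exact: (ac k k' x x').
have aFc : adapted m n.+1 F1 by exact: adaptedM.
have c0 (i : nat) x y : 0 <= c i x y by [].
have c1 (i : nat) x y : 0 <= 1 - c i x y by rewrite subr_ge0 lern1 leq_b1.
have F'0 k x : 0 <= F' k x by rewrite mulr_ge0.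
have F10 k x : 0 <= F1 k x by rewrite mulr_ge0.
pose F2 k x := F' k x * (crosses_between n.+1 j x)%:R.
pose F3 k x := F' k x * (beta^-1 ^+ j * U k x n.+1 (x n.+1)).
have aF2 : adapted m (n.+1 + j) F2.
  apply: adaptedM; last exact: adapted_crosses_between.
  by apply: sub_adapted aF' => //; rewrite leq_addr.
have aF3 : adapted m n.+1 F3 by apply: adaptedM aF' _; apply: aU; lia.
have F20 k x : 0 <= F2 k x by rewrite mulr_ge0.
have F30 k x : 0 <= F3 k x by rewrite !mulr_ge0// exprn_ge0.
apply: (@le_trans _ _ 'E[fun k x => F1 k x + F2 k x]).
  apply: (@integral_le_traj m (n + j.+1) m (n.+1 + j)
    (fun k x => F k x * (crosses_between n j.+1 x)%:R)
    (fun k x => F1 k x + F2 k x)).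
  - apply: adaptedM; last exact: adapted_crosses_between.
    by apply: sub_adapted aF => //; rewrite leq_addr.
  - move=> k k' x x' kk' xx'; rewrite (aF2 k k' x x')//; congr (_ + _).
    by apply: (aFc k k' x x') => // i i_n; apply: xx'; rewrite (leq_trans i_n)// leq_addr.
  - by move=> k x; rewrite mulr_ge0.
  - by move=> k x; rewrite addr_ge0.
  move=> k x _; rewrite /F1 /F2 /F' -mulrA -mulrDr ler_wpM2l//.
  rewrite /crosses_between /= /cross_step.
  by case: (_ && _); case: (has _ _); rewrite /=; lra.
rewrite (integralD_adapted aFc aF2)//.
apply: (@le_trans _ _ ('E[F1] + 'E[F3])%E).
  by rewrite leeD2l//; apply: IH => //; lia.
rewrite -(integralD_adapted aFc aF3)//.
apply: (@le_trans _ _ 'E[fun k x => F k x * (beta^-1 ^+ j.+1 * U k x n.+1 (x n))]).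
  apply: (integral_next_le (m := m) (n := n) (n' := n) hX
    (G := fun k x y => F k x * c n x y +
       F k x * (1 - c n x y) * (beta^-1 ^+ j * U k x n.+1 y))
    (F := fun k x => F k x * (beta^-1 ^+ j.+1 * U k x n.+1 (x n)))); first lia.
  - move=> k k' x x' kk' xx'; apply/funext => y; rewrite (aF k k' x x')//.
    rewrite (@adapted_potential n y k k' x x') /cross_step ?xx'// => i i_n.
    by apply: kk'; lia.
  - by move=> k x y; rewrite addr_ge0// !mulr_ge0// exprn_ge0.
  - move=> k k' x x' kk' xx'; rewrite (aF k k' x x')// xx'//.
    rewrite (@adapted_potential n (x' n) k k' x x')// => i i_n.
    by apply: kk'; lia.
  - by move=> k x; rewrite !mulr_ge0// exprn_ge0.
  move=> k x kx; rewrite mulrCA exprSr -mulrA.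
  apply: (@le_trans _ _ (F k x * (beta^-1 ^+ j *
     \sum_(y <- endpoints (tree s k x n.+1) (x n))
     @payoff R V (inl v) (inl w) (U k x n.+1) (x n) y))).
    rewrite !mulr_sumr; apply: ler_sum => y _.
    rewrite -mulrA -mulrDr ler_wpM2l// /payoff /cross_step xpair_eqE.
    case: (_ && _) => /=; last lra.
    by rewrite subrr mul0r addr0 mulr1 exprn_ege1.
  rewrite ler_wpM2l// mulrCA ler_wpM2l ?exprn_ge0//.
  exact: sum_payoff_potential.
apply: (@integral_le_traj m n m n
  (fun k x => F k x * (beta^-1 ^+ j.+1 * U k x n.+1 (x n)))
  (fun k x => F k x * (beta^-1 ^+ j.+1 * U k x n (x n)))).
- move=> k k' x x' kk' xx'; rewrite (aF k k' x x')// xx'//.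
  rewrite (@adapted_potential n (x' n) k k' x x')// => i i_n.
  by apply: kk'; lia.
- by apply: adaptedM aF _; apply: aU; lia.
- by move=> k x; rewrite !mulr_ge0// exprn_ge0.
- by move=> k x; rewrite !mulr_ge0// exprn_ge0.
by move=> k x kx; rewrite ler_wpM2l// ler_wpM2l ?exprn_ge0// potential_growth_noninc.
Qed.

End DiscountedCrossings.

(** * Dyadic blocks of times and the summability of their bounds *)

Lemma bernoulli_inequality (R : realFieldType) (a : R) n :
  0 <= a <= 1 -> 1 - n%:R * a <= (1 - a) ^+ n.
Proof.
case/andP=> a0 a1; elim: n => [|n IH]; first by rewrite mul0r subr0.
rewrite exprS; apply: (@le_trans _ _ ((1 - a) * (1 - n%:R * a))).
  have : 0 <= n%:R * a ^+ 2 by rewrite mulr_ge0// sqr_ge0.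
  by rewrite -natr1; lra.
by rewrite ler_wpM2l// subr_ge0.
Qed.

Section Blocks.
Context (R : realType) (s : nat).
Implicit Types (k : nat -> nat).
Hypothesis s_gt0 : (0 < s)%N.

(** With the successor, the growth at time [s * 2 ^ i] has taken place by time [block i]. As
    [block i.+1 < 2 * block i], the intervals from [block i] to twice [block i] leave no gap. *)
Definition block (i : nat) : nat := (s * 2 ^ i).+1.

(** By Bernoulli's inequality the discount over [block i] steps is still at least one half. *)
Definition block_beta i : R := 1 - (2 * (block i)%:R)^-1.

Definition leaves k n : nat := (\sum_(1 <= j < n.+1) k (s * j))%N.

(** For [L = block i] and [S] leaves this is [2 * 2 / (1 + S / (2 * L))]: one factor 2 for the
    discount before time [L], one for the discount within the block. *)
Definition block_bound i k : R :=
  8 * (block i)%:R / (2 * (block i)%:R + (leaves k (2 ^ i))%:R).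

Lemma block_beta_gt0_le1 i : 0 < block_beta i <= 1.
Proof.
have L1 : 1 <= (block i)%:R :> R by rewrite ler1n.
have L2 : 1 < 2 * (block i)%:R :> R by lra.
have L0 : 0 < 2 * (block i)%:R :> R by lra.
by rewrite /block_beta subr_gt0 gerBl invr_ge0 ltW// andbT invf_lt1.
Qed.

Lemma rate_block i k : (block_beta i)^-1 ^+ block i *
  rate s (block_beta i) k (block i) <= block_bound i k.
Proof.
have /andP[b0 b1] := block_beta_gt0_le1 i.
set L := block i; set S := leaves k (2 ^ i).
have L1 : 1 <= L%:R :> R by rewrite ler1n.
have L0 : 0 < L%:R :> R by rewrite ltr0n.
set a : R := (2 * L%:R)^-1.
have a0 : 0 < a by rewrite invr_gt0 mulr_gt0.
have bE : block_beta i = 1 - a by [].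
have La : L%:R * a = 2^-1 by rewrite /a; field; rewrite gt_eqF.
have half : 2^-1 <= block_beta i ^+ L.
  have := @bernoulli_inequality R a L; rewrite -bE La; move=> h.
  apply: le_trans (h _); first lra.
  by rewrite ltW//=; move: b0; rewrite bE; lra.
have sumE : \sum_(0 <= j < L) delta s (block_beta i) k j =
    (\sum_(0 <= j < (2 ^ i).+1) k (s * j))%:R * (1 - block_beta i ^+ 2).
  rewrite natr_sum mulr_suml -(big_multiples _ (fun j => (k j)%:R * _) _ s_gt0).
  by rewrite [RHS]big_mkcond.
have den : 1 + S%:R * a <= 1 + \sum_(0 <= j < L) delta s (block_beta i) k j.
  rewrite lerD2l sumE; apply: ler_pM => //; first exact: ltW.
    by rewrite ler_nat [leqRHS]big_ltn// leq_addl.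
  (* Indeed [1 - (1 - a) ^+ 2 = a + a * (1 - a)], which is at least [a]. *)
  rewrite bE; have : 0 <= a * (1 - a) by rewrite mulr_ge0 ?ltW// -bE.
  by rewrite expr2; lra.
have den0 : 0 < 1 + S%:R * a by rewrite ltr_wpDr// mulr_ge0// ltW.
set q := block_beta i ^+ L in half *.
have q0 : 0 < q by rewrite (lt_le_trans _ half).
apply: (@le_trans _ _ (q^-1 * (q^-1 / (1 + S%:R * a)))).
  rewrite exprVn ler_wpM2l ?invr_ge0 ?(ltW q0)//.
  apply: le_trans (rate_le _ b0 b1 _ _) _.
  rewrite ler_wpM2l ?invr_ge0 ?(ltW q0)// lef_pV2// ?posrE//.
  exact: lt_le_trans den.
apply: (@le_trans _ _ (2 * (2 / (1 + S%:R * a)))).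
  have q2 : q^-1 <= 2 by rewrite -[leRHS]invrK lef_pV2 ?posrE// invr_gt0.
  have iq0 : 0 <= q^-1 by rewrite invr_ge0 ltW.
  apply: ler_pM => //; first by rewrite divr_ge0// ltW.
  by rewrite ler_wpM2r// invr_ge0 ltW.
rewrite /block_bound -/L -/S /a le_eqVlt; apply/orP; left; apply/eqP.
field; rewrite !gt_eqF//=.
by rewrite ltr_wpDr// mulr_gt0.
Qed.

Lemma block_bound_ge0 i k : 0 <= block_bound i k.
Proof. by rewrite divr_ge0// ?addr_ge0 ?mulr_ge0. Qed.

Lemma block_bound_le4 i k : block_bound i k <= 4.
Proof.
rewrite ler_pdivrMr; last by rewrite ltr_wpDr// mulr_gt0// ltr0n.
have : 0 <= (leaves k (2 ^ i))%:R :> R by [].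
lra.
Qed.

Lemma eq_block_bound i k k' : (forall j, (j <= s * 2 ^ i)%N -> k j = k' j) ->
  block_bound i k = block_bound i k'.
Proof.
move=> kk'; rewrite /block_bound /leaves (@eq_big_nat _ _ _ _ _ _ (fun j => k' (s * j)%N))//.
by move=> j /andP[_ jn]; rewrite kk'// leq_pmul2l.
Qed.

Lemma leaves_le k m n : (m <= n)%N -> (leaves k m <= leaves k n)%N.
Proof. by move=> mn; rewrite /leaves (@big_cat_nat _ _ _ m.+1 1 n.+1)//= leq_addr. Qed.

(* Cauchy condensation: the i-th block bound is of the order of
   2 ^ i / S_(2 ^ i). *)
Lemma sum_block_bound (C : R) (f : nat -> R) (n0 : nat) k : 0 < C ->
  (forall n, (0 < n)%N -> 0 < f n) ->
  (\sum_(1 <= n <oo) ((f n)^-1)%:E < +oo)%E ->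
  (forall n, (n0 <= n)%N -> C * f n <= (leaves k n)%:R) ->
  exists K : nat, forall n, \sum_(0 <= i < n.+1) block_bound i k <= K%:R.
Proof.
move=> C0 f0 ffin kf.
have fV0 n : (0 < n)%N -> 0 <= (f n)^-1 by move=> n0'; rewrite invr_ge0 ltW// f0.
have [M fM] := partial_sum_bounded fV0 ffin.
(* For [m = 2 ^ i], the numerator is [8 * (2 * s * m + 1)], at most [32 * s * m]; the division by
   [C] comes from the bound on the leaves. *)
pose D := 32 * s%:R / C.
have D0 : 0 <= D by rewrite divr_ge0 ?mulr_ge0// ltW.
have condense i : (n0 <= i)%N ->
    block_bound i.+1 k <= D * \sum_((2 ^ i).+1 <= j < (2 ^ i.+1).+1) (f j)^-1.
  move=> n0i; set m := (2 ^ i)%N.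
  have m0 : (0 < m)%N by rewrite expn_gt0.
  have m2 : (2 ^ i.+1 = 2 * m)%N by rewrite expnS.
  have im : (n0 <= m)%N by rewrite (leq_trans n0i)// ltnW// ltn_expl.
  set S : R := (leaves k (2 ^ i.+1))%:R.
  have S0 : 0 < S.
    apply: lt_le_trans (kf _ _); first by rewrite mulr_gt0// f0// m2; lia.
    by rewrite m2; lia.
  (* Each of the [m] indices [j] from [m + 1] to [2 * m] satisfies [C * f j <= S], the number of
     leaves being monotone. *)
  have low : m%:R * S^-1 <= \sum_(m.+1 <= j < (2 ^ i.+1).+1) (C * f j)^-1.
    have -> : m%:R * S^-1 = \sum_(m.+1 <= j < (2 ^ i.+1).+1) S^-1.
      by rewrite sumr_const_nat -[RHS]mulr_natl m2 mul2n -addnn subSS addnK.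
    apply: ler_sum_nat => j /andP[mj jm].
    have fj : 0 < f j by apply: f0; lia.
    rewrite lef_pV2 ?posrE ?mulr_gt0//; apply: le_trans (kf _ _) _; first lia.
    by rewrite ler_nat leaves_le.
  have -> : D * \sum_(m.+1 <= j < (2 ^ i.+1).+1) (f j)^-1 =
      32 * s%:R * \sum_(m.+1 <= j < (2 ^ i.+1).+1) (C * f j)^-1.
    rewrite !mulr_sumr; apply: eq_big_nat => j /andP[mj _].
    have fj : 0 < f j by apply: f0; lia.
    by rewrite /D; field; rewrite !gt_eqF.
  apply: (@le_trans _ _ (32 * s%:R * (m%:R * S^-1))); last first.
    by rewrite ler_wpM2l// mulr_ge0.
  rewrite /block_bound -/S mulrA.
  have blockE : (block i.+1)%:R = 2 * s%:R * m%:R + 1 :> R.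
    by rewrite /block m2 -natr1 !natrM; ring.
  have sm : 1 <= s%:R * m%:R :> R by rewrite -natrM ler1n muln_gt0 s_gt0.
  rewrite ler_pdivrMr; last by rewrite ltr_wpDl// mulr_ge0.
  rewrite mulrDr blockE mulfVK ?gt_eqF//.
  rewrite (@le_trans _ _ (32 * s%:R * m%:R))//; first lra.
  by rewrite lerDr !mulr_ge0// ?invr_ge0 ?(ltW S0)// addr_ge0// !mulr_ge0.
have fM0 : 0 <= M by apply: le_trans (fM 1%N); rewrite big_geq.
(* The blocks up to [n0] are bounded by 4 each, the later ones by [condense]. *)
have bound n : \sum_(0 <= i < n.+1) block_bound i k <=
    4 * (minn n.+1 n0.+1)%:R + D * \sum_(1 <= j < (2 ^ n).+1) (f j)^-1.
  elim: n => [|n IH].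
    rewrite big_nat1 minnSS min0n mulr1 (le_trans (block_bound_le4 _ _))//.
    by rewrite lerDl mulr_ge0// big_nat sumr_ge0// => j /andP[j0 _]; exact: fV0.
  have le2 : ((2 ^ n).+1 <= (2 ^ n.+1).+1)%N by rewrite ltnS leq_exp2l.
  rewrite big_nat_recr//= [in leRHS](big_cat_nat _ le2)//= mulrDr addrA.
  have tail0 : 0 <= \sum_((2 ^ n).+1 <= j < (2 ^ n.+1).+1) (f j)^-1.
    by rewrite big_nat sumr_ge0// => j /andP[j0 _]; apply: fV0; lia.
  have [n0n|nn0] := leqP n0 n.
    apply: lerD; last exact: condense.
    apply: le_trans IH _; rewrite lerD2r ler_wpM2l// ler_nat; lia.
  have := mulr_ge0 D0 tail0; have := block_bound_le4 n.+1 k.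
  have -> : minn n.+2 n0.+1 = (minn n.+1 n0.+1).+1 by lia.
  by rewrite -natr1; lra.
pose B := 4 * n0.+1%:R + D * M.
exists (Num.truncn B).+1 => n; apply: le_trans (bound n) _.
apply: (@le_trans _ _ B); last by rewrite ltW// truncnS_gt.
by rewrite lerD// ler_wpM2l// ler_nat; lia.
Qed.

End Blocks.

(** * Almost sure events and measurability *)

Section AlmostSure.
Context (R : realType) (d : measure_display) (Omega : measurableType d)
  (P : probability Omega R).

Lemma ae_of_probability1 (A : set Omega) : measurable A -> P A = 1%E ->
  {ae P, forall w, A w}.
Proof.
move=> mA PA; exists (~` A); split=> //; first exact: measurableC.
by rewrite probability_setC// PA subee.
Qed.

Lemma probability1_of_ae (A : set Omega) : measurable A ->
  {ae P, forall w, A w} -> P A = 1%E.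
Proof.
move=> mA aeA.
have PAC : P (~` A) = 0%E by apply: measure_negligible => //; exact: measurableC.
have := probability_setC P (measurableC mA); rewrite setCK PAC => ->.
by rewrite sube0.
Qed.

Lemma measurable_exists (C : countType) (Q : C -> Omega -> Prop) :
  (forall c, measurable [set w | Q c w]) -> measurable [set w | exists c, Q c w].
Proof.
move=> mQ; rewrite [X in measurable X](_ : _ = \bigcup_c [set w | Q c w]).
  exact: countable_bigcupT_measurable.
by apply/seteqP; split=> w [c]; [exists c|exists c].
Qed.

Lemma measurable_forall (Q : nat -> Omega -> Prop) :
  (forall n, measurable [set w | Q n w]) -> measurable [set w | forall n, Q n w].
Proof.
move=> mQ; rewrite [X in measurable X](_ : _ = \bigcap_n [set w | Q n w]).
  exact: bigcapT_measurable.
by apply/seteqP; split=> w Qw => [n _|n]; exact: Qw.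
Qed.

End AlmostSure.

(** * Almost sure bounds on crossings and on the number of leaves *)

Section TBRW.
Context (R : realType) (s : nat) (T0 : rooted_tree) (x0 : vert T0)
  (d : measure_display) (Omega : measurableType d) (P : probability Omega R)
  (xi : nat -> {RV P >-> nat}) (X : nat -> Omega -> vertex T0).
Hypothesis hX : is_TBRW s x0 xi X.
Hypothesis s_gt0 : (0 < s)%N.
Local Notation V := (vertex T0).

(** The hypothesis of [ae_finitely_often] for block crossings. The truncation [D] depends on the
    environment only, so it can serve as the weight in the bound of crossings by the potential and
    in that of the potential by [rate]; [rate_block] concludes. *)
Lemma cross_block_le (v w : vert T0) K t : (self_loop T0 -> v = tree_root T0) ->
  (P ([set u | crosses_between v w (block s t) (block s t) (X ^~ u)] `&`
      sum_le (fun i u => block_bound R s i (xi ^~ u)) K t) <=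
   \int[P]_u (block_bound R s t (xi ^~ u) *
      \1_(sum_le (fun i u => block_bound R s i (xi ^~ u)) K t) u)%:E)%E.
Proof.
move=> v_root; set L := block s t; set E := [set u | _].
set S := sum_le _ K t.
pose D (k : nat -> nat) : R :=
  ((\sum_(0 <= i < t.+1) block_bound R s i k <= K%:R)%R)%:R.
pose m := (L + L)%N.
have [b0 b1] := andP (block_beta_gt0_le1 R s t).
have L_gt : (s * 2 ^ t < L)%N by [].
have aB i k k' : (i <= t)%N -> (forall j, (j <= m)%N -> k j = k' j) ->
    block_bound R s i k = block_bound R s i k'.
  move=> it kk'; apply: eq_block_bound => // j ji; apply: kk'.
  rewrite (leq_trans ji)// (@leq_trans (s * 2 ^ t))//; last by rewrite /m; lia.
  by rewrite leq_pmul2l// leq_exp2l.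
have aD k k' : (forall j, (j <= m)%N -> k j = k' j) -> D k = D k'.
  move=> kk'; rewrite /D; congr ((nat_of_bool (_ <= _))%:R).
  by apply: eq_big_nat => i /andP[_ it]; exact: aB.
have D0 k : 0 <= D k by [].
have DE u : \1_S u = D (xi ^~ u) by rewrite indicE /S /D /sum_le mem_setE.
have IE u : \1_(E `&` S) u = D (xi ^~ u) * (crosses_between v w L L (X ^~ u))%:R.
  rewrite indicI [LHS]/= DE mulrC indicE; congr (_ * (nat_of_bool _)%:R).
  by apply/idP/idP; rewrite inE.
have mE : measurable E.
  apply: (measurable_adapted_set hX (m := 0%N) (n := (L + L)%N)
    (Q := fun _ x => crosses_between v w L L x)).
  move=> k k' x x' kk' xx'; apply/propext.
  have /eqP := @adapted_crosses_between R T0 v w 0 L L k k' x x' kk' xx'.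
  by rewrite eqr_nat => /eqP; do 2!case: crosses_between.
have mS : measurable S.
  apply: measurable_sum_le => i.
  apply: (measurable_adapted_fun hX (m := (s * 2 ^ i)%N) (n := 0%N)
    (F := fun k _ => block_bound R s i k)).
  by move=> k k' x x' kk' _; exact: eq_block_bound.
rewrite -[X in P X]setIT -integral_indic//; last exact: measurableI.
under eq_integral do rewrite IE.
under [leRHS]eq_integral do rewrite DE.
apply: (@le_trans _ _ (\int[P]_u (D (xi ^~ u) * ((block_beta R s t)^-1 ^+ L *
    potential s v (block_beta R s t) (xi ^~ u) (X ^~ u) L (X L u)))%:E)%E).
  have := crossing_le_potential (m := m) (j := L) (n := L) hX w v_root b0 b1
    (F := fun k _ => D k); apply => //.
  by move=> k k' x x' kk' _; exact: aD.
pose c := (block_beta R s t)^-1 ^+ L.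
have c0 : 0 <= c by rewrite exprn_ge0// invr_ge0 ltW.
apply: (@le_trans _ _ (\int[P]_u (D (xi ^~ u) * c *
    potential s v (block_beta R s t) (xi ^~ u) (X ^~ u) L (X L u))%:E)%E).
  by under eq_integral do rewrite mulrA.
apply: (@le_trans _ _ (\int[P]_u (D (xi ^~ u) * c *
    rate s (block_beta R s t) (xi ^~ u) L)%:E)%E).
  apply: (expected_potential_le_rate (m := m) (n := L) hX w v_root b0 b1
    (F := fun k => D k * c)) => //.
  - by rewrite /m leq_addr.
  - by move=> k k' kk'; rewrite (aD k k').
  - by move=> k; rewrite mulr_ge0.
apply: (@integral_le_traj R s T0 x0 d Omega P xi X hX m 0 m 0
  (fun k _ => D k * c * rate s (block_beta R s t) k L)
  (fun k _ => block_bound R s t k * D k)).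
- move=> k k' x x' kk' _; rewrite (aD k k')// (@eq_rate _ _ _ k k')// => i iL.
  by apply: kk'; rewrite /m; lia.
- by move=> k k' x x' kk' _; rewrite (aD k k')// (aB t k k').
- by move=> k x; apply: mulr_ge0; [exact: mulr_ge0|exact/ltW/rate_gt0].
- by move=> k x; rewrite mulr_ge0// block_bound_ge0.
move=> k x _; rewrite -mulrA [leRHS]mulrC ler_wpM2l//.
exact: rate_block.
Qed.

(** Only finitely many blocks contain a crossing, and the later blocks cover all large times. *)
Lemma ae_no_crossing_io (v w : vert T0) : (self_loop T0 -> v = tree_root T0) ->
  {ae P, forall u,
    (exists K : nat, forall n,
       \sum_(0 <= i < n.+1) block_bound R s i (xi ^~ u) <= K%:R) ->
    ~ crosses_io (X ^~ u) (inl v) (inl w)}.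
Proof.
move=> v_root.
pose E t := [set u | crosses_between v w (block s t) (block s t) (X ^~ u)].
have mE t : measurable (E t).
  apply: (measurable_adapted_set hX (m := 0%N) (n := (block s t + block s t)%N)
    (Q := fun _ x => crosses_between v w (block s t) (block s t) x)).
  move=> k k' x x' kk' xx'; apply/propext.
  have /eqP := @adapted_crosses_between R T0 v w 0 _ _ k k' x x' kk' xx'.
  by rewrite eqr_nat => /eqP; do 2!case: crosses_between.
have mp t : measurable_fun setT (fun u => block_bound R s t (xi ^~ u)).
  apply: (measurable_adapted_fun hX (m := (s * 2 ^ t)%N) (n := 0%N)
    (F := fun k _ => block_bound R s t k)).
  by move=> k k' x x' kk' _; exact: eq_block_bound.
have := ae_finitely_often (P := P) mE mp
  (fun t u => block_bound_ge0 _ _ _ _) (fun K t => cross_block_le w K t v_root).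
apply: filterS => u fo /fo[N noE] io.
have [t Nt [xt xt1]] := io (block s N).
have : exists i, (t < block s i.+1)%N.
  exists t; rewrite ltnS (@leq_trans (2 ^ t.+1))//; last exact: leq_pmull.
  by rewrite ltnW// (ltn_trans (ltnSn t))// ltn_expl.
move=> /ex_minnP[i ti imin].
(* By minimality of [i]; for [i = 0], because [t] is at least [block s N]. *)
have it : (block s i <= t)%N.
  case: i ti imin => [_ _|i _ imin].
    by apply: leq_trans Nt; rewrite ltnS leq_pmul2l// leq_exp2l.
  by rewrite leqNgt; apply/negP => /imin; rewrite ltnn.
have Ni : (N <= i)%N.
  rewrite -ltnS -(@ltn_exp2l 2)// -(@ltn_pmul2l s)//.
  by have := leq_ltn_trans Nt ti; rewrite /block ltnS.
apply: (noE i Ni); apply/hasP; exists t; last by rewrite xt xt1 !eqxx.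
rewrite mem_iota it /=; apply: leq_trans ti _.
by rewrite /block expnS mulnCA; lia.
Qed.

Lemma measurable_visits_io (z : V) :
  measurable [set u | forall N, exists2 m, (N <= m)%N & X m u = z].
Proof.
apply: measurable_forall => N.
rewrite [X in measurable X](_ : _ = [set u | exists m, (N <= m)%N /\ X m u = z]).
  apply: measurable_exists => m; have [Nm|mN] := boolP (N <= m)%N.
    rewrite [X in measurable X](_ : _ = X m @^-1` [set z]).
      exact: measurable_X hX m _.
    by apply/seteqP; split=> u //= [].
  rewrite [X in measurable X](_ : _ = set0)//.
  by apply/seteqP; split=> u //= [].
by apply/seteqP; split=> u /= [m]; [exists m|case=> Nm ?; exists m].
Qed.

Lemma measurable_trapped : measurable [set u | exists n, trapped_at X n u].
Proof.
apply: measurable_exists => n; apply: measurable_forall => m.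
apply: (measurable_adapted_set hX (m := 0%N) (n := (n + 2 * m)%N)
  (Q := fun _ x => x (n + 2 * m)%N = x n)).
by move=> k k' x x' _ xx'; rewrite !xx'// leq_addr.
Qed.

Lemma measurable_random_tree n (Q : graph V -> Prop) :
  measurable [set u | Q (random_tree s xi X n u)].
Proof.
apply: (measurable_adapted_set hX (m := n) (n := n)
  (Q := fun k x => Q (tree s k x n))).
move=> k k' x x' kk' xx'.
by rewrite (@eq_tree _ s k k' x x')// => i i_n; rewrite ?kk' ?xx'// ltnW.
Qed.

Lemma measurable_periodic : measurable [set u | exists (x : V) (k : nat),
  (exists n, x \in vertices (random_tree s xi X n u)) /\
  forall n, X (s * n + k)%N u = x].
Proof.
apply: measurable_exists => x; apply: measurable_exists => k.
apply: measurableI.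
  apply: measurable_exists => n.
  exact: (measurable_random_tree n (fun T => x \in vertices T)).
by apply: measurable_forall => n; exact: (measurable_X hX _ [set x]).
Qed.

Lemma measurable_leaves n (a : R) :
  measurable_fun setT (fun u => ((S_ s xi n u)%:R * a)%:E).
Proof.
apply/measurable_EFinP.
apply: (measurable_adapted_fun hX (m := (s * n)%N) (n := 0%N)
  (F := fun k _ => (leaves s k n)%:R * a)) => k k' x x' kk' _.
rewrite /leaves (@eq_big_nat _ _ _ _ _ _ (fun j => k' (s * j)%N))//.
by move=> j /andP[_ jn]; rewrite kk'// leq_pmul2l.
Qed.

(** Doubling [c] gives the strict inequality that turns a bound on the limit superior into an
    eventual bound. *)
Lemma ae_leaves_le (c : R) (g : nat -> R) : 0 < c ->
  (forall n, (0 < n)%N -> 0 < g n) ->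
  P [set u | (limn_esup (fun n => ((S_ s xi n u)%:R / g n)%:E) <= c%:E)%E] = 1%E ->
  {ae P, forall u, exists n0, forall n, (n0 <= n)%N ->
    (S_ s xi n u)%:R <= 2 * c * g n}.
Proof.
move=> c0 g0 /ae_of_probability1 aeS.
have {aeS} : {ae P, forall u,
    (limn_esup (fun n => ((S_ s xi n u)%:R / g n)%:E) <= c%:E)%E}.
  apply: aeS; rewrite -[X in measurable X]setTI.
  apply: emeasurable_fun_infty_c => //.
  by apply: measurable_fun_limn_esup => n; exact: measurable_leaves.
apply: filterS => u le_c.
have [|N leN] := @limn_esup_lt _ (fun n => ((S_ s xi n u)%:R / g n)%:E) (2 * c)%:E.
  by apply: le_lt_trans le_c _; rewrite lte_fin; lra.
exists (maxn 1 N) => n; rewrite geq_max => /andP[n0 Nn].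
by have := leN n Nn; rewrite lte_fin ltr_pdivrMr ?g0// => /ltW.
Qed.

Lemma ae_leaves_ge (c : R) (f : nat -> R) : 0 < c ->
  (forall n, (0 < n)%N -> 0 < f n) ->
  P [set u | (c%:E <= limn_einf (fun n => ((S_ s xi n u)%:R / f n)%:E))%E] = 1%E ->
  {ae P, forall u, exists n0, forall n, (n0 <= n)%N ->
    c / 2 * f n <= (S_ s xi n u)%:R}.
Proof.
move=> c0 f0 /ae_of_probability1 aeS.
have {aeS} : {ae P, forall u,
    (c%:E <= limn_einf (fun n => ((S_ s xi n u)%:R / f n)%:E))%E}.
  apply: aeS.
  (* The limit inferior is rewritten as minus the limit superior of the opposite sequence, whose
     measurability is available. *)
  rewrite [X in measurable X](_ : _ = setT `&` [set u |
    (limn_esup (fun n => ((S_ s xi n u)%:R * - (f n)^-1)%:E) <= (- c)%:E)%E]).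
    apply: emeasurable_fun_infty_c => //.
    by apply: measurable_fun_limn_esup => n; exact: measurable_leaves.
  rewrite setTI; apply/funext => u; apply/propext => /=.
  rewrite [X in limn_esup X](_ : _ = -%E \o (fun n => ((S_ s xi n u)%:R / f n)%:E)).
    by rewrite limn_esupN EFinN leeN2.
  by apply/funext => n /=; rewrite mulrN EFinN.
apply: filterS => u le_c.
have [|N leN] := @limn_einf_gt _ (fun n => ((S_ s xi n u)%:R / f n)%:E) (c / 2)%:E.
  by apply: lt_le_trans le_c; rewrite lte_fin; lra.
exists (maxn 1 N) => n; rewrite geq_max => /andP[n0 Nn].
by have := leN n Nn; rewrite lte_fin ltr_pdivlMr ?f0// => /ltW.
Qed.

End TBRW.

(** * The two regimes *)

Section MainResults.
Context (R : realType) (s : nat) (T0 : rooted_tree) (x0 : vert T0)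
  (d : measure_display) (Omega : measurableType d) (P : probability Omega R)
  (xi : nat -> {RV P >-> nat}) (X : nat -> Omega -> vertex T0).
Hypothesis hX : is_TBRW s x0 xi X.
Hypothesis s_gt0 : (0 < s)%N.
Hypothesis s_even : ~~ odd s.
Local Notation V := (vertex T0).

Lemma recurrent_of_ae :
  {ae P, forall u, forall n z, z \in vertices (random_tree s xi X n u) ->
    forall N, exists2 m, (N <= m)%N & X m u = z} -> recurrent s xi X.
Proof.
move=> ae_io n T x B PB z zT; rewrite /cond_prob.
set A := [set u | forall N, _].
have mA : measurable A by exact: (measurable_visits_io hX).
have mB : measurable B.
  apply: (measurable_adapted_set hX (m := n) (n := n)
    (Q := fun k x' => tree s k x' n = T /\ x' n = x)).
  move=> k k' y y' kk' yy'; rewrite yy'//.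
  by rewrite (@eq_tree _ s k k' y y')// => i i_n; rewrite ?kk' ?yy'// ltnW.
(* On [B] the tree at time [n] is [T], so missing [z] from some time on contradicts the almost sure
   statement. *)
have PBA : P (B `\` A) = 0%E.
  apply: measure_negligible; first by apply: measurableD.
  apply: negligibleS ae_io => u [[uT _] nA] io; apply: nA => N.
  by apply: (io n); rewrite uT.
have -> : P (A `&` B) = P B.
  by have := measureDI P mB mA; rewrite [X in (X + _)%E]PBA add0e setIC => ->.
by rewrite divff// gt_eqF// fine_gt0// PB ltey_eq fin_num_measure.
Qed.

Lemma TBRW_recurrent (c : R) (g : nat -> R) : 0 < c ->
  (forall n, (0 < n)%N -> 0 < g n) ->
  (\sum_(1 <= n <oo) ((g n)^-1)%:E = +oo)%E ->
  P [set u | (limn_esup (fun n => ((S_ s xi n u)%:R / g n)%:E) <= c%:E)%E] = 1%E ->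
  recurrent s xi X.
Proof.
move=> c0 g0 gdiv PS; apply: recurrent_of_ae.
apply: filterS3 (ae_trajectory hX) (ae_crosses_io hX)
  (ae_leaves_le hX s_gt0 c0 g0 PS) => u traj io_iff [n0 leS].
have v_root : self_loop T0 -> tree_root T0 = tree_root T0 by [].
have [noc|] := pselect (forall a b, ~ crosses_io (X ^~ u) a b); last first.
  by move=> /existsNP[a /existsNP[b /contrapT ab]] n z;
    exact: (visits_io_everywhere traj io_iff v_root ab).
have [t oddt trap] := trapped_if_no_crosses_io v_root traj s_even noc.
exfalso; apply: (noc (X t u) (X t.+1 u)).
by apply: (trapped_crosses_io traj s_gt0 s_even io_iff (C := 2 * c) (g := g)
  (n0 := n0) (t := t)) => //; rewrite mulr_gt0.
Qed.

Lemma TBRW_trapped (c : R) (f : nat -> R) : 0 < c ->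
  (forall n, (0 < n)%N -> 0 < f n) ->
  (\sum_(1 <= n <oo) ((f n)^-1)%:E < +oo)%E ->
  P [set u | (c%:E <= limn_einf (fun n => ((S_ s xi n u)%:R / f n)%:E))%E] = 1%E ->
  {ae P, forall u, exists2 t, ~~ odd t & trapped_at X t u}.
Proof.
move=> c0 f0 ffin PS.
(* The self-loop is taken if there is one, so that [v] is its vertex; otherwise [has_edge] provides
   an ordinary edge. *)
have [v [w [v_root vw]]] : exists v w : vert T0,
    (self_loop T0 -> v = tree_root T0) /\
    ((inl v, inl w) : V * V) \in edges (initial_graph T0).
  case: (boolP (self_loop T0)) => [sl|nsl].
    exists (tree_root T0), (tree_root T0); split=> //.
    apply/imfsetP; exists (tree_root T0, tree_root T0) => //=.
    by rewrite inE /= sl !eqxx orbT.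
  have [sl|[a [b ab]]] := has_edge T0; first by rewrite sl in nsl.
  exists a, b; split=> //; apply/imfsetP; exists (a, b) => //=.
  by rewrite inE /= ab.
have no_vw : {ae P, forall u, ~ crosses_io (X ^~ u) (inl v) (inl w)}.
  apply: filterS2 (ae_leaves_ge hX s_gt0 c0 f0 PS)
    (ae_no_crossing_io hX s_gt0 w v_root) => u [n0 geS]; apply.
  by apply: (sum_block_bound s_gt0 _ f0 ffin geS); rewrite divr_gt0.
apply: filterS3 (ae_trajectory hX) (ae_crosses_io hX) no_vw => u traj io_iff {}no_vw.
(* An edge crossed infinitely often would spread its crossings to [v], and from there to the edge
   from [v] to [w]. *)
apply: (trapped_if_no_crosses_io v_root traj s_even) => a b ab.
have swap := crosses_io_swap io_iff.
have vT : (inl v : V) \in vertices (tree s (xi ^~ u) (X ^~ u) 0).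
  by apply/imfsetP; exists v.
have [q vq] := crosses_io_everywhere v_root traj swap ab vT.
by apply: no_vw; exact: (swap 0%N _ _ q).
Qed.

End MainResults.

Unset Implicit Arguments.

Theorem theorem1p1 (R : realType) (s : nat) (hs : (2 <= s)%N)
    (s_even : ~~ odd s) (T0 : rooted_tree) (x0 : vert T0)
    (d : measure_display) (Omega : measurableType d) (P : probability Omega R)
    (xi : nat -> {RV P >-> nat}) (X : nat -> Omega -> vertex T0)
    (hX : is_TBRW s x0 xi X) :
  ((exists (c : R) (g : nat -> R),
      [/\ 0 < c, forall n, (0 < n)%N -> 0 < g n,
          (\sum_(1 <= n <oo) ((g n)^-1)%:E = +oo)%E
        & P [set w | (limn_esup (fun n => ((S_ s xi n w)%:R / g n)%:E)
                      <= c%:E)%E] = 1%E]) ->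
    recurrent s xi X)
  /\
  (mutually_independent xi ->
   (exists (c : R) (f : nat -> R),
      [/\ 0 < c, forall n, (0 < n)%N -> 0 < f n,
          (\sum_(1 <= n <oo) ((f n)^-1)%:E < +oo)%E
        & P [set w | (c%:E <=
                      limn_einf (fun n => ((S_ s xi n w)%:R / f n)%:E))%E]
          = 1%E]) ->
    P [set w | exists n, trapped_at X n w] = 1%E /\
    P [set w | exists (x : vertex T0) (k : nat),
                 (exists n, x \in vertices (random_tree s xi X n w)) /\
                 forall n, X (s * n + k)%N w = x] = 1%E).
Proof.
have s_gt0 : (0 < s)%N by exact: ltnW.
split=> [[c [g [c0 g0 gdiv PS]]]|_ [c [f [c0 f0 ffin PS]]]].
  exact: (TBRW_recurrent hX s_gt0 s_even c0 g0 gdiv PS).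
have ae_trap := TBRW_trapped hX s_gt0 s_even c0 f0 ffin PS.
split; apply: probability1_of_ae.
- exact: (measurable_trapped hX).
- by apply: filterS ae_trap => w [t _ trap]; exists t.
- exact: (measurable_periodic hX).
apply: filterS2 ae_trap (ae_trajectory hX) => w [t _ trap] traj.
(* Trapping gives period 2 from time [t] on, and [s * n] is even. *)
exists (X t w), t; split.
  by exists t; have := traj_mem (v := tree_root T0) (fun=> erefl) traj (leqnn t).
move=> n; have := trap ((s * n)./2); congr (X _ w = _).
have := odd_double_half (s * n); rewrite oddM (negbTE s_even) -mul2n; lia.
Qed.
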